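(* Let $X_0$ and $X_1$ be two Banach ideal spaces on $I$ with the Fatou property, where $I=[0,1]$, $I=[0,\infty)$ or $I=\mathbb{N}$, and let $\varphi\in\mathcal U$. If either $X_0,X_1$ are symmetric spaces, or $C,C^*$ are bounded on both $X_0$ and $X_1$, then $$\varphi(\widetilde{X_0},\widetilde{X_1})=[\varphi(X_0,X_1)]^{\sim}.$$
   Context: Let $I$ be $[0,1]$ or $[0,\infty)$ with Lebesgue measure $m$, or $\mathbb{N}$ with counting measure $m$; $L^0=L^0(I)$ is the set of equivalence classes of real-valued measurable functions on $I$. A Banach ideal space $X$ on $I$ is a Banach space $X\subset L^0(I)$ such that $f,g\in L^0$, $|f|\le|g|$ a.e., $g\in X$ imply $f\in X$ and $\|f\|_X\le\|g\|_X$; it is assumed to contain some $f$ with $f(x)>0$ for each $x\in I$. $X$ has the Fatou property if $0\le f_n\nearrow f$ a.e., $f_n\in X$ and $\sup_n\|f_n\|_X<\infty$ imply $f\in X$ and $\|f_n\|_X\nearrow\|f\|_X$. A symmetric space is a Banach ideal space $X$ such that if $f\in X$ and $g\in L^0$ is equimeasurable with $f$ (i.e. $m(\{|f|>\lambda\})=m(\{|g|>\lambda\})$ for all $\lambda\ge0$), then $g\in X$ and $\|g\|_X=\|f\|_X$. $X=Y$ means the spaces coincide as sets with equivalent norms. For $I=[0,1]$ or $[0,\infty)$: $Cf(x)=\frac1x\int_0^xf(t)\,dt$, $C^*f(x)=\int_{I\cap[x,\infty)}\frac{f(t)}{t}\,dt$, $\widetilde f(x)=\operatorname{ess\,sup}_{t\in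 I,\,t\ge x}|f(t)|$. For $I=\mathbb{N}$: $(Ca)_n=\frac1n\sum_{k=1}^na_k$, $(C^*a)_n=\sum_{k=n}^\infty\frac{a_k}{k}$, $\widetilde a_n=\sup_{k\ge n}|a_k|$. The Tandori space is $\widetilde X=X^{\sim}=\{f\in L^0:\widetilde f\in X\}$ with $\|f\|_{\widetilde X}=\|\widetilde f\|_X$. $\mathcal U$ is the class of functions $\varphi:\mathbb{R}_+\times\mathbb{R}_+\to\mathbb{R}_+$ that are positively homogeneous ($\varphi(\lambda s,\lambda t)=\lambda\varphi(s,t)$ for all $s,t,\lambda\ge0$) and concave on $\mathbb{R}_+\times\mathbb{R}_+$, where $\mathbb{R}_+=[0,\infty)$. The Calderón–Lozanovskiĭ space $\varphi(X_0,X_1)$ is the set of all $f\in L^0$ such that $|f|\le\lambda\varphi(|f_0|,|f_1|)$ a.e. on $I$ for some $\lambda>0$ and some $f_i\in X_i$ with $\|f_i\|_{X_i}\le1$, $i=0,1$; its norm is the infimum of such $\lambda$. *)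

(* Defs.v *)
From HB Require Import structures.
From mathcomp Require Import all_boot all_order all_algebra.
From mathcomp Require Import all_classical all_reals all_analysis.
From mathcomp Require Import ess_sup_inf.

Set Implicit Arguments.
Unset Strict Implicit.
Unset Printing Implicit Defensive.

Import Order.TTheory GRing.Theory Num.Theory.
Import numFieldNormedType.Exports.

Local Open Scope classical_set_scope.
Local Open Scope ring_scope.

(* A space of (classes of) functions is given by the set of all representatives
   of its elements, together with its norm read on representatives.  The axioms
   of [banach_ideal] make membership and norm depend only on the a.e. class.
   [fnorm] is meaningful on members only. *)
Record fspace (T : Type) (R : realType) := FSpace {
  carrier :> (T -> R) -> Prop ;
  fnorm : (T -> R) -> R }.

Definition same_fspace (T : Type) (R : realType) (X Y : fspace T R) : Prop :=
  (forall f, X f <-> Y f) /\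
  exists A B : R, [/\ 0 < A, 0 < B &
    forall f, X f -> A * fnorm X f <= fnorm Y f <= B * fnorm X f].

(* [defined A f] says that the integral or series in [apply A f] converges
   (a.e.); the values of [apply A] are irrelevant otherwise. *)
Record operator (T : Type) (R : realType) := Operator {
  defined : (T -> R) -> Prop ;
  apply : (T -> R) -> T -> R }.

Definition bounded_on (T : Type) (R : realType) (A : operator T R)
    (X : fspace T R) : Prop :=
  exists K : R, forall f, X f ->
    [/\ defined A f, X (apply A f) & fnorm X (apply A f) <= K * fnorm X f].

Section ideal_spaces.
Context (d : measure_display) (T : measurableType d) (R : realType).
Variable mu : {measure set T -> \bar R}.
Implicit Types (X : fspace T R) (f g : T -> R).

Record banach_ideal X : Prop := BanachIdeal {
  bi_measurable : forall f, X f -> measurable_fun [set: T] f ;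
  bi_add : forall f g, X f -> X g -> X (f \+ g) ;
  bi_scale : forall (a : R) f, X f -> X (fun x => a * f x) ;
  bi_normD : forall f g, X f -> X g ->
    fnorm X (f \+ g) <= fnorm X f + fnorm X g ;
  bi_normZ : forall (a : R) f, X f ->
    fnorm X (fun x => a * f x) = `|a| * fnorm X f ;
  bi_norm0 : forall f, X f -> fnorm X f = 0 -> \forall x \ae mu, f x = 0 ;
  bi_complete : forall u : nat -> T -> R, (forall n, X (u n)) ->
    (forall e : R, 0 < e -> exists N : nat, forall m n : nat,
       (N <= m)%N -> (N <= n)%N -> fnorm X (u m \- u n) < e) ->
    exists2 f, X f & (fun n => fnorm X (u n \- f)) @ \oo --> (0 : R) ;
  bi_ideal : forall f g, measurable_fun [set: T] f -> X g ->
    (\forall x \ae mu, `|f x| <= `|g x|) -> X f /\ fnorm X f <= fnorm X g ;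
  bi_positive : exists2 f, X f & \forall x \ae mu, 0 < f x }.

Definition fatou_property X : Prop :=
  forall (u : nat -> T -> R) f,
    measurable_fun [set: T] f ->
    (forall n, X (u n)) ->
    (\forall x \ae mu, [/\ forall n, 0 <= u n x,
       nondecreasing_seq (fun n => u n x) & (fun n => u n x) @ \oo --> f x]) ->
    (exists M : R, forall n, fnorm X (u n) <= M) ->
    [/\ X f, nondecreasing_seq (fun n => fnorm X (u n)) &
        (fun n => fnorm X (u n)) @ \oo --> fnorm X f].

Definition equimeasurable f g : Prop :=
  forall l : R, 0 <= l ->
    mu [set x | l < `|f x|] = mu [set x | l < `|g x|].

Definition symmetric_space X : Prop :=
  banach_ideal X /\
  forall f g, X f -> measurable_fun [set: T] g -> equimeasurable f g ->
    X g /\ fnorm X g = fnorm X f.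

(* Only the values of [phi] on nonnegative arguments matter. *)
Record class_U (phi : R -> R -> R) : Prop := ClassU {
  U_ge0 : forall s t, 0 <= s -> 0 <= t -> 0 <= phi s t ;
  U_homogeneous : forall l s t, 0 <= l -> 0 <= s -> 0 <= t ->
    phi (l * s) (l * t) = l * phi s t ;
  U_concave : forall a s t s' t', 0 <= a <= 1 ->
    0 <= s -> 0 <= t -> 0 <= s' -> 0 <= t' ->
    a * phi s t + (1 - a) * phi s' t' <=
    phi (a * s + (1 - a) * s') (a * t + (1 - a) * t') }.

Definition cl_bound (phi : R -> R -> R) X0 X1 f (l : R) : Prop :=
  0 < l /\ exists f0 f1,
    [/\ X0 f0 /\ fnorm X0 f0 <= 1, X1 f1 /\ fnorm X1 f1 <= 1 &
        \forall x \ae mu, `|f x| <= l * phi `|f0 x| `|f1 x|].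

Definition calderon_lozanovskii (phi : R -> R -> R) X0 X1 : fspace T R :=
  FSpace
    (fun f => measurable_fun [set: T] f /\
              exists l, cl_bound phi X0 X1 f l)
    (fun f => inf [set l | cl_bound phi X0 X1 f l]).

(* [tld] is the least nonincreasing majorant, which may take the value +oo;
   f is in the Tandori space when it is a.e. finite and belongs to X. *)
Definition tandori_of (tld : (T -> R) -> T -> \bar R) X : fspace T R :=
  FSpace
    (fun f => [/\ measurable_fun [set: T] f,
       \forall x \ae mu, tld f x \is a fin_num & X (fine \o tld f)])
    (fun f => fnorm X (fine \o tld f)).

End ideal_spaces.

Record setting (R : realType) := Setting {
  disp : measure_display ;
  pts : measurableType disp ;
  msr : {measure set pts -> \bar R} ;
  cesaro_op : operator pts R ;
  copson_op : operator pts R ;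
  majorant : (pts -> R) -> pts -> \bar R }.

(* Functions on an interval J of nonnegative reals are represented by functions
   on R, identified when they agree almost everywhere on J: the measure is the
   restriction of the Lebesgue measure to J. *)
Section interval.
Context (R : realType) (J : set (measurableTypeR R)) (mJ : measurable J).
Local Notation leb := (@lebesgue_measure R).

Definition itv_measure : {measure set (measurableTypeR R) -> \bar R} :=
  mrestr leb mJ.

Definition itv_cesaro : operator (measurableTypeR R) R := Operator
  (fun f => \forall x \ae itv_measure,
     leb.-integrable `[0, x] (EFin \o f))
  (fun f x => x^-1 * \int[leb]_(t in `[0, x]) f t).

Definition itv_copson : operator (measurableTypeR R) R := Operator
  (fun f => \forall x \ae itv_measure,
     leb.-integrable (J `&` `[x, +oo[) (fun t => (f t / t)%:E))
  (fun f x => \int[leb]_(t in J `&` `[x, +oo[) (f t / t)).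

(* [\_] extends by 0, which does not change the essential supremum of |f|. *)
Definition itv_majorant (f : measurableTypeR R -> R) (x : R) : \bar R :=
  ess_sup leb ((fun t => `|f t|%:E) \_ (J `&` `[x, +oo[)).

Definition itv_setting : setting R :=
  Setting itv_measure itv_cesaro itv_copson itv_majorant.
End interval.

(* The term a_n of a sequence indexed by n >= 1 is stored at index n - 1. *)
Section sequences.
Context (R : realType).

Definition seq_cesaro : operator nat R := Operator
  (fun=> True)
  (fun a n => (n.+1%:R)^-1 * \sum_(0 <= k < n.+1) a k).

Definition seq_copson : operator nat R := Operator
  (fun a => forall n, cvgn (fun m => \sum_(n <= k < m) a k / k.+1%:R))
  (fun a n => \big[+%R/0]_(n <= k <oo) (a k / k.+1%:R)).

Definition seq_majorant (a : nat -> R) (n : nat) : \bar R :=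
  esups (fun k => `|a k|%:E) n.

Definition seq_setting : setting R :=
  Setting (@counting nat R) seq_cesaro seq_copson seq_majorant.
End sequences.

Inductive domain := UnitInterval | HalfLine | Naturals.

Definition setting_of (R : realType) (I : domain) : setting R :=
  match I with
  | UnitInterval => itv_setting (measurable_itv `[0 : R, 1])
  | HalfLine => itv_setting (measurable_itv `[0 : R, +oo[)
  | Naturals => seq_setting R
  end.

Definition tandori (R : realType) (I : domain)
    (X : fspace (pts (setting_of R I)) R) : fspace (pts (setting_of R I)) R :=
  tandori_of (msr (setting_of R I)) (@majorant _ (setting_of R I)) X.

(* Main.v *)
Require Import Defs.
From mathcomp Require Import all_boot all_order all_algebra.
From mathcomp Require Import all_classical all_reals all_analysis.
From mathcomp Require Import measurable_realfun ess_sup_inf.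
From mathcomp Require Import lra ring zify.

Set Implicit Arguments.
Unset Strict Implicit.
Unset Printing Implicit Defensive.

Import Order.TTheory GRing.Theory Num.Theory.
Import numFieldNormedType.Exports.

Local Open Scope classical_set_scope.
Local Open Scope ring_scope.

(** A function of the class U is nondecreasing in both variables.  Hence an
    estimate [|f| <= l phi(|f0|, |f1|)] valid a.e. to the right of [x] bounds
    [|f|] there by the value of [l phi] at the majorants of [f0] and [f1] at
    [x], so it passes to the majorant of [f]: the space built on the Tandori
    spaces embeds in the Tandori space of the space built on [X0] and [X1],
    with constant 1 ([cl_bound_majorant]).

    Conversely, let [F] be the least nonincreasing majorant of [f] and suppose
    that [F <= l phi(|f0|, |f1|)] a.e., with [f0] and [f1] in the unit balls.
    The factors are not monotone, so they have to be replaced by nonincreasing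
    functions [g0] and [g1].  It suffices that [|fi| <= gi x] on most of the
    window [[x/4, x]]: some [t] in the window is then good for both factors and
    for the estimate, and [F x <= F t <= l phi(|f0 t|, |f1 t|) <=
    l phi(g0 x, g1 x)] ([monotone_minorize]).  As [gi] is nonincreasing, it is
    its own majorant, hence belongs to the Tandori space of [Xi] as soon as it
    belongs to [Xi].  The theorem thus reduces to [monotone_control], a property
    of a single space: every [f] in the unit ball is exceeded, outside a quarter
    of the scale [x], by [g x] for a nonincreasing [g] of controlled norm.

    In a symmetric space, [g x] is the decreasing rearrangement of [f] at [x/4];
    by definition [|f|] exceeds it on a set of measure at most [x/4].  The
    dilation by 4 costs a factor 4: cut at rank [4 N], the dilated
    rearrangement is equimeasurable with a sum of four disjoint translates of
    the rearrangement cut at rank [N], and the Fatou property lets [N] grow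
    ([dilation_bounded]).

    If [C] and its dual [C'] are bounded, [g] is [32 C (C' |f|)].  It is
    nonincreasing, being the mean over initial segments of a nonincreasing
    function.  Moreover [C' |f|] at [x/4] is at most [4 C (C' |f|)] at [x],
    because the mean over the segment up to [x] counts a quarter of that value;
    the Markov inequality for [|f t| / t] on the window then bounds the measure
    of the set where [|f| > g x] ([averages_control]).

    Both arguments are carried out over a measure space whose points are
    compared through a rank [r] with values in the real line.  On an interval
    the rank is the identity; the index [n] of a sequence has rank [n + 1/2]. *)

(** * Measurability *)

Section measurability.
Context (d : measure_display) (T : measurableType d) (R : realType).
Implicit Types r g : T -> R.

Lemma measurable_preimage_setT g (B : set R) :
  measurable_fun [set: T] g -> measurable B -> measurable (g @^-1` B).
Proof. by move=> mg mB; rewrite -[X in measurable X]setTI; apply: mg. Qed.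

Lemma measurable_superlevel g (c : R) :
  measurable_fun [set: T] g -> measurable [set t | c < g t].
Proof.
move=> mg; rewrite [X in measurable X](_ : _ = g @^-1` `]c, +oo[).
  exact: measurable_preimage_setT.
by apply/seteqP; split => t /=; rewrite in_itv/= andbT.
Qed.

Lemma measurable_abs_superlevel g (c : R) :
  measurable_fun [set: T] g -> measurable [set t | c < `|g t|].
Proof.
move=> mg; apply: (measurable_superlevel (g := fun t => `|g t|)).
exact: measurableT_comp.
Qed.

Lemma measurable_window r (a b : R) :
  measurable_fun [set: T] r -> measurable [set t | a <= r t <= b].
Proof.
move=> mr; rewrite [X in measurable X](_ : _ = r @^-1` `[a, b]).
  exact: measurable_preimage_setT.
by apply/seteqP; split => t /=; rewrite in_itv.
Qed.

Lemma measurable_superlevels_ge0 g : (forall x, 0 <= g x) ->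
  (forall s, 0 <= s -> measurable [set x | s < g x]) ->
  measurable_fun [set: T] g.
Proof.
move=> g0 mg; apply: (measurability _ (RGenOInfty.measurableE R)).
move=> _ [_ [s ->] <-]; rewrite setTI.
rewrite [X in measurable X](_ : _ = [set x | s < g x]); last first.
  by apply/seteqP; split => x /=; rewrite in_itv/= andbT.
have [s0|s0] := leP 0 s; first exact: mg.
rewrite [X in measurable X](_ : _ = setT)//.
by apply/seteqP; split => x //= _; exact: lt_le_trans s0 (g0 x).
Qed.

Lemma measurable_invr_ge0 g : (forall x, 0 <= g x) ->
  measurable_fun [set: T] g -> measurable_fun [set: T] (fun x => (g x)^-1).
Proof.
move=> g0 mg; apply: measurable_superlevels_ge0 => [x|s s0]; first by rewrite invr_ge0.
rewrite [X in measurable X](_ : _ = g @^-1` [set y | 0 < y /\ s * y < 1]).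
  apply: measurable_preimage_setT => //.
  apply: is_interval_measurable => y z /= [y0 sy] [z0 sz] t /andP[yt tz].
  split; first exact: lt_le_trans y0 yt.
  by apply: le_lt_trans sz; rewrite ler_wpM2l.
apply/seteqP; split => x /=; have := g0 x; rewrite le_eqVlt => /predU1P[<-|gx].
- by rewrite invr0 ltNge s0.
- by rewrite -[s * _ < 1]ltr_pdivlMr// div1r.
- by rewrite ltxx => -[].
- by rewrite -[s * _ < 1]ltr_pdivlMr// div1r => -[].
Qed.

End measurability.

(** * Least nonincreasing majorants *)

(** Homogeneity turns concavity into superadditivity, and the increment
    [phi (s' - s) (t' - t)] is nonnegative. *)
Lemma class_U_monotone (R : realType) (phi : R -> R -> R) (s t s' t' : R) :
  class_U phi -> 0 <= s <= s' -> 0 <= t <= t' -> phi s t <= phi s' t'.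
Proof.
move=> [phi0 phiZ phiC] /andP[s0 ss'] /andP[t0 tt'].
have h : 0 <= (2^-1 : R) <= 1 by lra.
have := phiC 2^-1 (2 * s) (2 * t) (2 * (s' - s)) (2 * (t' - t)) h
  ltac:(lra) ltac:(lra) ltac:(lra) ltac:(lra).
rewrite !phiZ; [|lra..].
have := phi0 (s' - s) (t' - t) ltac:(lra) ltac:(lra).
have -> : 2^-1 * (2 * s) + (1 - 2^-1) * (2 * (s' - s)) = s' by field.
have -> : 2^-1 * (2 * t) + (1 - 2^-1) * (2 * (t' - t)) = t' by field.
by lra.
Qed.

Section rank.
Context (d : measure_display) (T : measurableType d) (R : realType).
Variables (mu : {measure set T -> \bar R}) (r : T -> R).
Implicit Types (X : fspace T R) (f g : T -> R).

(** The least nonincreasing majorant is determined by its sublevel sets; this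
    form covers essential suprema over half-lines as well as suprema over
    tails of sequences. *)
Record is_majorant (tld : (T -> R) -> T -> \bar R) : Prop := IsMajorant {
  majorant_ge0 : forall f x, (0 <= tld f x)%E ;
  majorant_le : forall f x c, 0 <= c ->
    (tld f x <= c%:E)%E <-> \forall y \ae mu, r x <= r y -> `|f y| <= c }.

(** The constant 1/4 leaves room for two functions: two exceptional sets of
    measure [r x / 4] do not fill a window of measure [3/4 * r x]. *)
Definition monotone_control X : Prop :=
  exists2 K : R, 0 < K & forall f, X f -> fnorm X f <= 1 ->
    exists g, [/\ X g, fnorm X g <= K,
      \forall x \ae mu, \forall y \ae mu, r x <= r y -> `|g y| <= g x &
      \forall x \ae mu,
        (mu [set t | (r x / 4 <= r t <= r x)%R /\ (g x < `|f t|)%R] <=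
         (r x / 4)%:E)%E].

(** Sublevel sets are preimages under [r] of intervals unbounded above. *)
Lemma measurable_rank_antitone (F : T -> \bar R) :
  measurable_fun [set: T] r -> (forall x y, r x <= r y -> (F y <= F x)%E) ->
  measurable_fun [set: T] F.
Proof.
move=> mr anti.
apply: (measurability _ (ErealGenInftyO.measurableE R)) => _ [_ [c ->] <-].
rewrite setTI [X in measurable X](_ : _ =
  r @^-1` [set s | exists2 x, (F x < c%:E)%E & r x <= s]); last first.
  apply/seteqP; split => x /=; rewrite in_itv/=; first by exists x.
  by move=> [y yc yx]; exact: le_lt_trans (anti _ _ yx) yc.
apply: measurable_preimage_setT => //.
apply: is_interval_measurable => s t /= [x xc xs] _ u /andP[su _].
by exists x => //; exact: le_trans xs su.
Qed.

Section tandori_spaces.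
Variable tld : (T -> R) -> T -> \bar R.
Hypothesis mr : measurable_fun [set: T] r.
Hypothesis tldP : is_majorant tld.

Lemma majorant_mono f x y : r x <= r y -> (tld f y <= tld f x)%E.
Proof.
move=> xy; have := majorant_ge0 tldP f x.
case E : (tld f x) => [c| |] //; rewrite ?leey// lee_fin => c0.
apply/(majorant_le tldP) => //.
have /(majorant_le tldP) : (tld f x <= c%:E)%E by rewrite E.
by move=> /(_ c0); apply: filterS => z h yz; apply: h; exact: le_trans xy yz.
Qed.

Lemma measurable_majorant f : measurable_fun [set: T] (tld f).
Proof. by apply: measurable_rank_antitone => //; exact: majorant_mono. Qed.

(** For rational [c], the set where the majorant is at most [c] is a final
    segment for the rank, and [|f| <= c] a.e. beyond each of its points.  The
    segment is covered by countably many such pieces: those above a rational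
    rank, and the points of least rank if there are any. *)
Lemma ae_le_majorant f : \forall x \ae mu, (`|f x|%:E <= tld f x)%E.
Proof.
(* The first conjunct treats the points above a rational that is itself above
   the rank of a point of the segment, the second one the points of least
   rank. *)
pose P (c : rat) y := 0 <= (ratr c : R) ->
  (forall q : rat, (exists2 x, (tld f x <= (ratr c)%:E)%E & r x <= ratr q) ->
     ratr q <= r y -> `|f y| <= ratr c) /\
  ((tld f y <= (ratr c)%:E)%E ->
     (forall z, (tld f z <= (ratr c)%:E)%E -> r y <= r z) -> `|f y| <= ratr c).
have aeP : \forall y \ae mu, forall c, P c y.
  suff h : forall n, \forall y \ae mu, if @unpickle rat n is Some c then P c y else True.
    move/ae_foralln : h; apply: filterS => y h c.
    by have := h (pickle c); rewrite pickleK.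
  move=> n; case: unpickle => [c|]; last exact: aeW.
  have [c0|c0] := leP 0 (ratr c : R); last first.
    by apply: aeW => y; rewrite /P leNgt c0.
  have h1 : \forall y \ae mu,
      forall q : rat, (exists2 x, (tld f x <= (ratr c)%:E)%E & r x <= ratr q) ->
        ratr q <= r y -> `|f y| <= ratr c.
    suff h : forall n, \forall y \ae mu, if @unpickle rat n is Some q then
       (exists2 x, (tld f x <= (ratr c)%:E)%E & r x <= ratr q) ->
        ratr q <= r y -> `|f y| <= ratr c else True.
      move/ae_foralln : h; apply: filterS => y h q.
      by have := h (pickle q); rewrite pickleK.
    move=> m; case: unpickle => [q|]; last exact: aeW.
    have [[x xc xq]|nx] := pselect (exists2 x, (tld f x <= (ratr c)%:E)%E &
      r x <= ratr q); last by apply: aeW => y /nx.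
    have /(majorant_le tldP _ _ c0) := xc.
    by apply: filterS => y h _ qy; apply: h; exact: le_trans qy.
  have h2 : \forall y \ae mu, ((tld f y <= (ratr c)%:E)%E ->
     (forall z, (tld f z <= (ratr c)%:E)%E -> r y <= r z) -> `|f y| <= ratr c).
    have [[x [xc xm]]|nx] := pselect (exists x, (tld f x <= (ratr c)%:E)%E /\
      (forall z, (tld f z <= (ratr c)%:E)%E -> r x <= r z)); last first.
      by apply: aeW => y yc ym; exfalso; apply: nx; exists y.
    have /(majorant_le tldP _ _ c0) := xc.
    by apply: filterS => y h yc _; apply: h; exact: xm.
  by apply: filterS2 h1 h2.
apply: filterS aeP => y h; rewrite leNgt; apply/negP => yl.
have := majorant_ge0 tldP f y; move: yl.
case E : (tld f y) => [a| |] //; rewrite lte_fin lee_fin => al a0.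
have [c] := rat_in_itvoo al; rewrite in_itv/= => /andP[ac cl].
have yc : (tld f y <= (ratr c)%:E)%E by rewrite E lee_fin ltW.
have [hq hm] := h c (ltW (le_lt_trans a0 ac)).
suff : `|f y| <= ratr c by rewrite leNgt cl.
have [[z zc zy]|nz] := pselect (exists2 z, (tld f z <= (ratr c)%:E)%E & r z < r y).
  have [q] := rat_in_itvoo zy; rewrite in_itv/= => /andP[zq qy].
  by apply: (hq q (ex_intro2 _ _ z _ _)) => //; exact: ltW.
apply: hm => // z zc; rewrite leNgt; apply/negP => zy.
by apply: nz; exists z.
Qed.

End tandori_spaces.
End rank.

(** * From monotone control to the commutation formula *)

Section calderon_lozanovskii_tandori.
Context (d : measure_display) (T : measurableType d) (R : realType).
Variables (mu : {measure set T -> \bar R}) (r : T -> R).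
Variable tld : (T -> R) -> T -> \bar R.
Variables (phi : R -> R -> R) (X0 X1 : fspace T R).
Implicit Types (X : fspace T R) (f g : T -> R).
Hypothesis mr : measurable_fun [set: T] r.
Hypothesis tldP : is_majorant mu r tld.
Hypothesis phiU : class_U phi.
Hypotheses (bX0 : banach_ideal mu X0) (bX1 : banach_ideal mu X1).

Let fine_majorant_ge0 f x : 0 <= fine (tld f x).
Proof. by rewrite fine_ge0// (majorant_ge0 tldP). Qed.

Let fine_majorantP f x : tld f x \is a fin_num ->
  \forall y \ae mu, r x <= r y -> `|f y| <= fine (tld f x).
Proof. by move=> fx; apply/(majorant_le tldP) => //; rewrite fineK. Qed.

Lemma cl_bound_majorant f l :
  cl_bound mu phi (tandori_of mu tld X0) (tandori_of mu tld X1) f l ->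
  cl_bound mu phi X0 X1 (fine \o tld f) l /\
  \forall x \ae mu, tld f x \is a fin_num.
Proof.
move=> [l0 [f0 [f1 [[[mf0 fin0 X0f0] n0] [[mf1 fin1 X1f1] n1] fle]]]].
have key : \forall x \ae mu,
    (tld f x <= (l * phi (fine (tld f0 x)) (fine (tld f1 x)))%:E)%E.
  apply: filterS2 fin0 fin1 => x fx0 fx1.
  apply/(majorant_le tldP).
    by rewrite mulr_ge0 ?(ltW l0)//; apply: (U_ge0 phiU).
  apply: filterS3 fle (fine_majorantP fx0) (fine_majorantP fx1) => y fy h0 h1 xy.
  apply: (le_trans fy); rewrite ler_pM2l//.
  by apply: class_U_monotone => //; rewrite normr_ge0/= ?h0 ?h1.
split; last first.
  apply: filterS key => x h.
  by rewrite ge0_fin_numE ?(majorant_ge0 tldP)//; exact: le_lt_trans h (ltry _).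
split => //; exists (fine \o tld f0), (fine \o tld f1); split => //.
apply: filterS key => x h /=.
rewrite !ger0_norm// -lee_fin fineK// ge0_fin_numE ?(majorant_ge0 tldP)//.
exact: le_lt_trans h (ltry _).
Qed.

Lemma in_tandori g :
  measurable_fun [set: T] g ->
  (\forall x \ae mu, \forall y \ae mu, r x <= r y -> `|g y| <= g x) ->
  \forall x \ae mu, tld g x \is a fin_num /\ `|fine (tld g x)| <= `|g x|.
Proof.
move=> mg; apply: filterS => x gx.
have h : (tld g x <= `|g x|%:E)%E.
  apply/(majorant_le tldP) => //; apply: filterS gx => y h xy.
  exact: le_trans (h xy) (ler_norm _).
have fx : tld g x \is a fin_num.
  by rewrite ge0_fin_numE ?(majorant_ge0 tldP)//; exact: le_lt_trans h (ltry _).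
by split => //; rewrite ger0_norm// -lee_fin fineK.
Qed.

Lemma monotone_tandori X g K : banach_ideal mu X -> X g -> 0 < K ->
  fnorm X g <= K ->
  (\forall x \ae mu, \forall y \ae mu, r x <= r y -> `|g y| <= g x) ->
  tandori_of mu tld X (fun x => K^-1 * g x) /\
  fnorm (tandori_of mu tld X) (fun x => K^-1 * g x) <= 1.
Proof.
move=> bX Xg K0 gK gmono; set g' := fun x => _.
have Xg' : X g' by exact: (bi_scale bX).
have mg' := bi_measurable bX Xg'.
have ng' : fnorm X g' <= 1.
  by rewrite (bi_normZ bX)// gtr0_norm ?invr_gt0// mulrC ler_pdivrMr// mul1r.
have gmono' : \forall x \ae mu, \forall y \ae mu, r x <= r y -> `|g' y| <= g' x.
  apply: filterS gmono => x; apply: filterS => y h xy.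
  by rewrite /g' normrM gtr0_norm ?invr_gt0// ler_pM2l ?invr_gt0// h.
have tg' := in_tandori mg' gmono'.
have [] := bi_ideal bX (f := fine \o tld g') _ Xg'.
- exact: measurableT_comp (measurable_majorant mr tldP g').
- by apply: filterS tg' => x [].
move=> XF nF; split; last exact: le_trans nF ng'.
by split => //; apply: filterS tg' => x [].
Qed.

(** The total measure [w / 4 + w / 4] of the two bad sets is smaller than
    [3 / 4 * w]. *)
Lemma exists_outside_bad_sets (W A B : set T) (N : set T) (w : R) :
  measurable W -> measurable A -> measurable B -> mu.-negligible N -> 0 < w ->
  ((3 / 4 * w)%:E <= mu W)%E -> (mu A <= (w / 4)%:E)%E ->
  (mu B <= (w / 4)%:E)%E ->
  exists t, [/\ W t, ~ A t, ~ B t & ~ N t].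
Proof.
move=> mW mA mB [N' [mN' N'0 NN']] w0 hW hA hB.
apply: contrapT => h.
have : (mu W <= mu (A `|` B `|` N'))%E.
  apply: le_measure; rewrite ?inE//; first by do 2 apply: measurableU => //.
  move=> t Wt; apply: contrapT => /not_orP[/not_orP[nA nB] nN'].
  by apply: h; exists t; split => // /NN'.
apply/negP; rewrite -ltNge.
apply: (le_lt_trans (y := (w / 4 + w / 4)%:E)); last first.
  by apply: lt_le_trans hW; rewrite lte_fin; lra.
apply: (le_trans (measureU2 mu (measurableU _ _ mA mB) mN')).
have {}N'0 : mu N' = 0%E by exact: N'0.
rewrite [X in (_ + X <= _)%E]N'0 adde0 (le_trans (measureU2 mu mA mB))// EFinD.
exact: leeD.
Qed.

Hypothesis window : \forall x \ae mu, 0 < r x /\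
  ((3 / 4 * r x)%:E <= mu [set t | (r x / 4 <= r t <= r x)%R])%E.

(** The pigeonhole step: the window at [x] contains a point [t] where the
    estimate holds and where neither factor exceeds its bound at [x]; the
    majorant of [f] only grows from [x] back to [t]. *)
Lemma monotone_minorize f l f0 f1 g0 g1 :
  measurable_fun [set: T] f0 -> measurable_fun [set: T] f1 -> 0 < l ->
  (\forall x \ae mu, tld f x \is a fin_num) ->
  (\forall x \ae mu, fine (tld f x) <= l * phi `|f0 x| `|f1 x|) ->
  (\forall x \ae mu, (mu [set t | (r x / 4 <= r t <= r x)%R /\
     (g0 x < `|f0 t|)%R] <= (r x / 4)%:E)%E) ->
  (\forall x \ae mu, (mu [set t | (r x / 4 <= r t <= r x)%R /\
     (g1 x < `|f1 t|)%R] <= (r x / 4)%:E)%E) ->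
  \forall x \ae mu, `|f x| <= l * phi `|g0 x| `|g1 x|.
Proof.
move=> mf0 mf1 l0 fin fle bad0 bad1.
have N : mu.-negligible (~` [set t | tld f t \is a fin_num /\
    fine (tld f t) <= l * phi `|f0 t| `|f1 t|]).
  by apply: filterS2 fin fle.
apply: filterS2 (filterI (ae_le_majorant tldP f) fin) (filterI window (filterI bad0 bad1)).
move=> x [fx finx] [[rx hw] [hb0 hb1]].
have [t [/= wt nA nB /contrapT [fint ft]]] :=
  exists_outside_bad_sets (measurable_window _ _ mr)
    (measurableI _ _ (measurable_window _ _ mr) (measurable_abs_superlevel (g0 x) mf0))
    (measurableI _ _ (measurable_window _ _ mr) (measurable_abs_superlevel (g1 x) mf1))
    N rx hw hb0 hb1.
have f0t : `|f0 t| <= `|g0 x|.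
  by apply: le_trans (ler_norm _); rewrite leNgt; apply/negP => ?; apply: nA.
have f1t : `|f1 t| <= `|g1 x|.
  by apply: le_trans (ler_norm _); rewrite leNgt; apply/negP => ?; apply: nB.
have /andP[_ tx] := wt.
apply: (@le_trans _ _ (fine (tld f x))); first by rewrite -lee_fin fineK.
apply: (@le_trans _ _ (fine (tld f t))).
  by rewrite fine_le// (majorant_mono tldP).
apply: (le_trans ft); rewrite ler_pM2l//.
by apply: class_U_monotone; rewrite // normr_ge0.
Qed.

(** The constants of equivalence are 1 in one direction and the larger of the
    two control constants in the other; the latter comes from normalizing the
    monotone factors. *)
Theorem calderon_lozanovskii_tandori_same :
  monotone_control mu r X0 -> monotone_control mu r X1 ->
  same_fspace
    (calderon_lozanovskii mu phi (tandori_of mu tld X0) (tandori_of mu tld X1))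
    (tandori_of mu tld (calderon_lozanovskii mu phi X0 X1)).
Proof.
move=> [K0 K0_gt0 ctrl0] [K1 K1_gt0 ctrl1].
pose K := Num.max K0 K1.
have K_gt0 : 0 < K by rewrite lt_max K0_gt0.
have back f l : (\forall x \ae mu, tld f x \is a fin_num) ->
    cl_bound mu phi X0 X1 (fine \o tld f) l ->
    cl_bound mu phi (tandori_of mu tld X0) (tandori_of mu tld X1) f (K * l).
  move=> fin [l0 [f0 [f1 [[Xf0 n0] [Xf1 n1] fle]]]].
  have [g0 [Xg0 gn0 gm0 bad0]] := ctrl0 _ Xf0 n0.
  have [g1 [Xg1 gn1 gm1 bad1]] := ctrl1 _ Xf1 n1.
  split; first exact: mulr_gt0.
  exists (fun x => K^-1 * g0 x), (fun x => K^-1 * g1 x); split.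
  - apply: (monotone_tandori _ _ K_gt0 _ gm0) => //; apply: (le_trans gn0).
    by rewrite le_max lexx.
  - apply: (monotone_tandori _ _ K_gt0 _ gm1) => //; apply: (le_trans gn1).
    by rewrite le_max lexx orbT.
  have fle' : \forall x \ae mu, fine (tld f x) <= l * phi `|f0 x| `|f1 x|.
    by apply: filterS fle => x; apply: le_trans; exact: ler_norm.
  have := monotone_minorize (bi_measurable bX0 Xf0) (bi_measurable bX1 Xf1)
    l0 fin fle' bad0 bad1.
  apply: filterS => x /le_trans; apply.
  rewrite !normrM gtr0_norm ?invr_gt0// (U_homogeneous phiU) ?invr_ge0 ?(ltW K_gt0)//.
  by rewrite (mulrC K) -mulrA (mulrA K) divff ?gt_eqF// mul1r.
have mfine f : measurable_fun [set: T] (fine \o tld f).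
  exact: measurableT_comp (measurable_majorant mr tldP f).
split.
  move=> f; split.
    move=> [mf [l hl]]; have [hl' fin] := cl_bound_majorant hl.
    by split => //; split => //; exists l.
  move=> [mf fin [_ [l hl]]]; split => //.
  by exists (K * l); exact: back.
exists K^-1, 1; split => //; first by rewrite invr_gt0.
move=> f [mf [l hl]]; have [hl' fin] := cl_bound_majorant hl.
have lb X Y g : has_lbound [set l | cl_bound mu phi X Y g l].
  by exists 0 => z [/ltW].
rewrite mul1r /=; apply/andP; split.
  apply: lb_le_inf; first by exists l.
  move=> z /= hz; rewrite ler_pdivrMl//; apply: ge_inf; first exact: lb.
  exact: back.
apply: lb_le_inf; first by exists l.
move=> z /= /cl_bound_majorant[hz _]; apply: ge_inf; [exact: lb|exact: hz].
Qed.

End calderon_lozanovskii_tandori.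

(** * Distribution functions *)

Section distribution.
Context (d : measure_display) (T : measurableType d) (R : realType).
Variables (mu : {measure set T -> \bar R}).
Implicit Types (X : fspace T R) (f g u v : T -> R).

Lemma fnorm_ge0 X f : banach_ideal mu X -> X f -> 0 <= fnorm X f.
Proof.
move=> bX Xf; have := bi_normD bX Xf (bi_scale bX (-1) Xf).
have := bi_normZ bX (-1) Xf; rewrite normrN1 mul1r => ->.
have -> : (f \+ (fun x => -1 * f x)) = (fun x => 0 * f x).
  by apply/funext => x /=; rewrite mulN1r subrr mul0r.
by have := bi_normZ bX 0 Xf; rewrite normr0 mul0r => ->; lra.
Qed.

Definition distribution f (s : R) : \bar R := mu [set x | s < `|f x|].

Lemma distribution_nonincreasing f s t : measurable_fun [set: T] f ->
  s <= t -> (distribution f t <= distribution f s)%E.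
Proof.
move=> mf st; apply: le_measure; rewrite ?inE;
  [exact: measurable_abs_superlevel..|].
by move=> x /=; exact: le_lt_trans.
Qed.

(** Continuity of the measure from below along the levels [s + 1/(n+1)]. *)
Lemma distribution_right_continuous f (s : R) (y : \bar R) :
  measurable_fun [set: T] f -> (y < distribution f s)%E ->
  exists2 t, s < t & (y < distribution f t)%E.
Proof.
move=> mf ys; pose F n := [set x | s + n.+1%:R^-1 < `|f x|].
have mF n : measurable (F n) by exact: measurable_abs_superlevel.
have UF : \bigcup_n F n = [set x | s < `|f x|].
  apply/seteqP; split => x /=.
    move=> [n _]; rewrite /F/=; apply: lt_trans.
    by rewrite ltrDl invr_gt0.
  move=> sx; have [n hn] := ltr_add_invr sx.
  by exists n.
have cF : (mu \o F) n @[n --> \oo] --> distribution f s.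
  rewrite /distribution -UF; apply: nondecreasing_cvg_mu => //.
    by rewrite UF; exact: measurable_abs_superlevel.
  move=> m n mn; apply/subsetPset => x; rewrite /F/=; apply: le_lt_trans.
  by rewrite lerD2l lef_pV2 ?posrE// ler_nat.
apply: contrapT => h.
suff : (distribution f s <= y)%E by rewrite leNgt ys.
rewrite -(cvg_lim _ cF)//; apply: lime_le; first by apply/cvg_ex; eexists; exact: cF.
apply: nearW => n; rewrite leNgt; apply/negP => yn; apply: h.
by exists (s + n.+1%:R^-1) => //; rewrite ltrDl invr_gt0.
Qed.

(** Continuity of the measure from above, which is available once some level
    set has finite measure, and finiteness of [f] everywhere. *)
Lemma distribution_vanishes f (s0 y : R) : measurable_fun [set: T] f ->
  (distribution f s0 < +oo)%E -> 0 < y ->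
  exists2 s, 0 <= s & (distribution f s <= y%:E)%E.
Proof.
move=> mf fs0 y0; pose F n := [set x | Num.max s0 0 + n%:R < `|f x|].
have mF n : measurable (F n) by exact: measurable_abs_superlevel.
have IF : \bigcap_n F n = set0.
  apply/seteqP; split => x //= h.
  have := archi_boundP (normr_ge0 (f x)); set n := Num.bound _ => hn.
  have := h n I; rewrite /F/= => /lt_trans => /(_ _ hn).
  by rewrite ltNge lerDr le_max lexx orbT.
have cF : (mu \o F) n @[n --> \oo] --> 0%E.
  rewrite -(measure0 mu) -IF; apply: nonincreasing_cvg_mu => //.
  - apply: le_lt_trans fs0; apply: distribution_nonincreasing => //.
    by rewrite addr0 le_max lexx.
  - by rewrite IF.
  - move=> m n mn; apply/subsetPset => x; rewrite /F/=; apply: le_lt_trans.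
    by rewrite lerD2l ler_nat.
apply: contrapT => h.
suff : (y%:E <= 0)%E by rewrite lee_fin leNgt y0.
rewrite -(cvg_lim _ cF)//; apply: lime_ge; first by apply/cvg_ex; eexists; exact: cF.
apply: nearW => n; rewrite leNgt; apply/negP => /ltW yn; apply: h.
by exists (Num.max s0 0 + n%:R) => //; rewrite addr_ge0// le_max lexx orbT.
Qed.

(** All indicators of sets of infinite measure are equimeasurable, so they
    have the same norm.  If every level set of [|f|] had infinite measure, the
    bound [n.+1%:R * \1_(n.+1%:R < |f|) <= |f|] would force this norm to be
    0. *)
Lemma symmetric_distribution_finite X f : symmetric_space mu X -> X f ->
  exists s, (distribution f s < +oo)%E.
Proof.
move=> [bX sX] Xf; apply: contrapT => h.
have mf := bi_measurable bX Xf.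
have Doo s : distribution f s = +oo%E.
  apply/eqP; rewrite -leye_eq leNgt; apply/negP => hs; apply: h; by exists s.
pose A n := [set x | n.+1%:R < `|f x|].
have mA n : measurable (A n) by exact: measurable_abs_superlevel.
pose i n : T -> R := \1_(A n).
have mi n : measurable_fun [set: T] (i n) by exact: measurable_indic.
have Xf' n : X (fun x => n.+1%:R^-1 * f x) by exact: (bi_scale bX).
have iX n : X (i n) /\ fnorm X (i n) <= n.+1%:R^-1 * fnorm X f.
  have -> : n.+1%:R^-1 * fnorm X f = fnorm X (fun x => n.+1%:R^-1 * f x).
    by rewrite (bi_normZ bX)// ger0_norm.
  apply: (bi_ideal bX) => //; apply: aeW => x.
  rewrite /i indicE normrM [X in _ <= X * _]ger0_norm ?invr_ge0//.
  case: (boolP (x \in A n)) => [|_]; last by rewrite normr0 mulr_ge0.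
  rewrite inE /A/= => /ltW hx; rewrite normr1 mulrC ler_pdivlMr//.
  by rewrite mul1r.
have levels n (l : R) : 0 <= l ->
    [set x | l < `|i n x|] = if l < 1 then A n else set0.
  move=> l0; apply/seteqP; split => x /=; rewrite /i indicE.
    case: (boolP (x \in A n)); rewrite ?inE ?normr1 ?normr0; last by rewrite ltNge l0.
    by move=> Ax ->.
  case: ifP => // l1 Ax; by rewrite mem_set// normr1.
have in0 n : fnorm X (i n) = fnorm X (i 0).
  have [] := sX (i 0) (i n) (iX 0).1 (mi n) _; last by [].
  move=> l l0; rewrite !levels//; case: ifP => // _.
  by rewrite [LHS](Doo 1%:R) [RHS](Doo n.+1%:R).
have : fnorm X (i 0) = 0.
  apply/eqP; rewrite eq_le (fnorm_ge0 bX (iX 0).1) andbT leNgt; apply/negP => i0.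
  have := archi_boundP (divr_ge0 (fnorm_ge0 bX Xf) (ltW i0)).
  set n := Num.bound _; rewrite ltr_pdivrMr// => hn.
  have := (iX n).2; rewrite in0 ler_pdivlMl// -natr1; nra.
move=> /(bi_norm0 bX (iX 0).1) [N [mN N0 hN]].
have : (mu (A 0%N) <= mu N)%E.
  apply: le_measure; rewrite ?inE// => x Ax; apply: hN => /=.
  by rewrite /i indicE mem_set//; apply/eqP; rewrite oner_eq0.
have -> : mu (A 0%N) = +oo%E by exact: Doo.
by have -> : mu N = 0%E by []; rewrite leye_eq.
Qed.

End distribution.

(** * Decreasing rearrangement *)

Section rearrangement.
Context (d : measure_display) (T : measurableType d) (R : realType).
Variables (mu : {measure set T -> \bar R}).
Implicit Types (X : fspace T R) (f g u v : T -> R).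

(** The decreasing rearrangement of [f].  Only [0 < y] is meaningful: at 0 the
    set of levels may be empty. *)
Definition rearr f (y : R) : R :=
  inf [set s | 0 <= s /\ (distribution mu f s <= y%:E)%E].

Lemma rearr_ge0 f y : 0 <= rearr f y.
Proof.
have [h|/set0P h] := eqVneq [set s | 0 <= s /\ (distribution mu f s <= y%:E)%E] set0.
  by rewrite /rearr h inf0.
by apply: lb_le_inf => // s [].
Qed.

Section finite_distribution.
Variable f : T -> R.
Hypothesis mf : measurable_fun [set: T] f.
Hypothesis ffin : exists s, (distribution mu f s < +oo)%E.

(** The generalized inverse of a right-continuous nonincreasing function; right
    continuity is what gives strict inequalities on both sides. *)
Lemma lt_rearr (s y : R) : 0 <= s -> 0 < y ->
  (s < rearr f y) = (y%:E < distribution mu f s)%E.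
Proof.
move=> s0 y0; apply/idP/idP => [sy|ys].
  rewrite ltNge; apply/negP => h; move: sy; rewrite ltNge => /negP; apply.
  by apply: ge_inf; [exists 0 => t []|].
have [t st yt] := distribution_right_continuous mf ys.
apply: (lt_le_trans st); apply: lb_le_inf.
  have [s1 fs1] := ffin.
  by have [z z0 hz] := distribution_vanishes mf fs1 y0; exists z.
move=> z [z0 hz]; rewrite leNgt; apply/negP => zt.
have := distribution_nonincreasing mu mf (ltW zt).
by move=> /(lt_le_trans yt)/lt_le_trans/(_ hz); rewrite ltxx.
Qed.

Lemma rearr_nonincreasing (x y : R) : 0 < x -> x <= y -> rearr f y <= rearr f x.
Proof.
move=> x0 xy; rewrite leNgt; apply/negP => h.
have := h; rewrite lt_rearr ?rearr_ge0 ?(lt_le_trans x0 xy)// => yd.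
have : rearr f x < rearr f x.
  rewrite lt_rearr ?rearr_ge0//; apply: le_lt_trans yd; by rewrite lee_fin.
by rewrite ltxx.
Qed.

End finite_distribution.

Lemma distribution_disjoint u v (l : R) : measurable_fun [set: T] u ->
  measurable_fun [set: T] v -> 0 <= l -> (forall x, u x = 0 \/ v x = 0) ->
  distribution mu (u \+ v) l = (distribution mu u l + distribution mu v l)%E.
Proof.
move=> mu_ mv l0 uv; rewrite /distribution -measureU//;
  [|exact: measurable_abs_superlevel..|]; last first.
  apply/seteqP; split => x //= [].
  by have [->|->] := uv x; rewrite normr0 [l < 0]ltNge l0.
congr (mu _); apply/seteqP; split => x /=.
  by have [->|->] := uv x; rewrite ?add0r ?addr0; [right|left].
by have [->|->] := uv x; rewrite ?add0r ?addr0 normr0 [l < 0]ltNge l0 => -[].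
Qed.

End rearrangement.

(** * Symmetric spaces *)

Section symmetric_control.
Context (d : measure_display) (T : measurableType d) (R : realType).
Variables (mu : {measure set T -> \bar R}) (r : T -> R).
Implicit Types (X : fspace T R) (f g u v : T -> R).

(** [V] holds the finite values of the measure: all reals for an interval, the
    natural numbers for the counting measure.  The rank sends the measure to
    Lebesgue measure as far as slabs with end points in [V] can see, and this
    is enough to transplant rearrangements.  The cutoffs [N k] leave room for
    four slabs of measure [N k], and [4 * N k] exhausts the space. *)
Record rank_function (V : set R) (N : nat -> R) : Prop := RankFunction {
  rank_measurable : measurable_fun [set: T] r ;
  rank_gt0 : \forall x \ae mu, 0 < r x ;
  values0 : V 0 ;
  valuesD : forall a b, V a -> V b -> V (a + b) ;
  values_measure : forall A, measurable A -> (mu A < +oo)%E ->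
    V (fine (mu A)) ;
  rank_slab : forall a b, V a -> V b -> 0 <= a <= b ->
    (b%:E <= mu [set: T])%E ->
    mu [set x | a < r x < b] = (b - a)%:E ;
  cutoff_values : forall k, V (N k) ;
  cutoff_ge0 : forall k, 0 <= N k ;
  cutoff_mono : nondecreasing_seq N ;
  cutoff_total : forall k, ((4 * N k)%:E <= mu [set: T])%E ;
  cutoff_exhaust : \forall x \ae mu, exists k, r x < 4 * N k }.

Variables (V : set R) (N : nat -> R).
Hypothesis rk : rank_function V N.
Let mr := rank_measurable rk.

Section one_function.
Variables (X : fspace T R) (f : T -> R).
Hypotheses (sX : symmetric_space mu X) (Xf : X f).
Let bX : banach_ideal mu X := sX.1.
Let mf : measurable_fun [set: T] f := bi_measurable bX Xf.
Let ffin := symmetric_distribution_finite sX Xf.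
Let D := distribution mu f.

Let D_ge0 s : (0 <= D s)%E. Proof. exact: measure_ge0. Qed.

Let V_D s : (D s < +oo)%E -> V (fine (D s)).
Proof. by apply: (values_measure rk); exact: measurable_abs_superlevel. Qed.

(** The rearrangement of [f] transplanted to the points of rank between [a] and
    [b]: [a] translates it, [c] rescales it. *)
Definition rearr_on (b : itv_bound R) (a c : R) (x : T) : R :=
  if (a < r x) && (BLeft (r x) < b)%O then rearr mu f (c * (r x - a)) else 0.

Lemma rearr_on_ge0 b a c x : 0 <= rearr_on b a c x.
Proof. by rewrite /rearr_on; case: ifP => // _; exact: rearr_ge0. Qed.

Lemma lt_rearr_on b a c x (s : R) : 0 <= s -> 0 < c ->
  (s < rearr_on b a c x) =
  [&& a < r x, (BLeft (r x) < b)%O & ((c * (r x - a))%:E < D s)%E].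
Proof.
move=> s0 c0; rewrite /rearr_on.
case: (ltP a (r x)) => [ax|_] /=; last by rewrite ltNge s0.
case: ifP => _; last by rewrite ltNge s0.
by rewrite lt_rearr// mulr_gt0// subr_gt0.
Qed.

Lemma measurable_rearr_on b a c : 0 < c ->
  measurable_fun [set: T] (rearr_on b a c).
Proof.
move=> c0; apply: measurable_superlevels_ge0; first exact: rearr_on_ge0.
move=> s s0.
rewrite [X in measurable X](_ : _ = r @^-1` [set y | [&& a < y,
  (BLeft y < b)%O & ((c * (y - a))%:E < D s)%E]]).
  apply: measurable_preimage_setT => //; apply: is_interval_measurable.
  move=> y z /= /and3P[ay yb yD] /and3P[az zb zD] t /andP[yt tz].
  apply/and3P; split; first exact: lt_le_trans ay yt.
    apply: le_lt_trans zb; by rewrite bnd_simp.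
  by apply: le_lt_trans zD; rewrite lee_fin ler_pM2l// lerB.
by apply/seteqP; split => x /=; rewrite lt_rearr_on.
Qed.

(** The rearrangement itself, read through the rank, is equimeasurable with
    [f]: its level set at [l] is the slab between 0 and [D l]. *)
Lemma rearr_on_equimeasurable :
  X (rearr_on +oo%O 0 1) /\ fnorm X (rearr_on +oo%O 0 1) = fnorm X f.
Proof.
apply: (sX.2 f) => //; first exact: measurable_rearr_on.
move=> l l0; rewrite -/(distribution mu f l) -/D.
under [in RHS]eq_set do rewrite ger0_norm ?rearr_on_ge0//.
have full : mu [set x | 0 < r x] = mu setT.
  apply/eqP; rewrite eq_le le_measure ?inE//=; last exact: measurable_superlevel.
  have [Z [mZ Z0 hZ]] := rank_gt0 rk.
  apply: (@le_trans _ _ (mu ([set x | 0 < r x] `|` Z))).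
    apply: le_measure; rewrite ?inE//.
      by apply: measurableU => //; exact: measurable_superlevel.
    move=> x _; have [|nx] := pselect (0 < r x); first by left.
    by right; apply: hZ.
  apply: (le_trans (measureU2 _ _ _)) => //; first exact: measurable_superlevel.
  by rewrite [X in (_ + X <= _)%E](Z0 : mu Z = 0%E) adde0.
have [Dfin|Dinf] := ltP (D l) +oo%E; last first.
  have DT : (D l <= mu setT)%E.
    by apply: le_measure; rewrite ?inE//; exact: measurable_abs_superlevel.
  have /eqP -> : D l == +oo%E by rewrite -leye_eq.
  rewrite (_ : [set x | _] = [set x | 0 < r x]).
    by rewrite full; apply/esym/eqP; rewrite -leye_eq (le_trans Dinf).
  apply/seteqP; split => x /=; rewrite lt_rearr_on//=.
    by move=> /andP[].
  by move=> ->; apply: lt_le_trans Dinf; rewrite ltry.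
have fD : D l \is a fin_num by rewrite ge0_fin_numE.
rewrite (_ : [set x | _] = [set x | 0 < r x < fine (D l)]); last first.
  apply/seteqP; split => x /=; rewrite lt_rearr_on//= mul1r subr0
    -[r x < fine _]lte_fin fineK//.
rewrite (rank_slab rk) ?subr0 ?fineK//; [exact: values0 rk|exact: V_D| |].
  by rewrite lexx fine_ge0.
by apply: le_measure; rewrite ?inE//; exact: measurable_abs_superlevel.
Qed.

Section cutoff.
Variable k : nat.
Let n := N k.
Let n0 : 0 <= n := cutoff_ge0 rk k.

(* The measure of the level set at [l] of the rearrangement cut at [n], that
   is, the minimum of [D l] and [n]. *)
Let trunc_value l := if (D l < n%:E)%E then fine (D l) else n.

Let trunc_value_ge0 l : 0 <= trunc_value l.
Proof. by rewrite /trunc_value; case: ifP => // _; exact: fine_ge0. Qed.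

Let trunc_value_le l : trunc_value l <= n.
Proof.
rewrite /trunc_value; case: ifP => // /ltW h; rewrite -lee_fin fineK//.
by rewrite ge0_fin_numE// (le_lt_trans h)// ltry.
Qed.

Let VMn a j : V a -> V (a *+ j).
Proof.
move=> Va; elim: j => [|j IH]; first exact: (values0 rk).
by rewrite mulrSr; exact: (valuesD rk).
Qed.

Let V_trunc_value l : V (trunc_value l).
Proof.
rewrite /trunc_value; case: ifP => [h|_]; last exact: (cutoff_values rk k).
by apply: V_D; apply: lt_trans h _; rewrite ltry.
Qed.

(** For [q = 1] this is a translate of the rearrangement cut at [n]; for
    [a = 0] and [q = 4] it is the cut dilation.  In both cases the level sets
    are slabs starting at [a]. *)
Lemma distribution_rearr_on a q l : V a -> 0 <= a -> (0 < q)%N -> 0 <= l ->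
  ((a + n *+ q)%:E <= mu [set: T])%E ->
  distribution mu (rearr_on (BLeft (a + n *+ q)) a q%:R^-1) l =
  (trunc_value l *+ q)%:E.
Proof.
move=> Va a0 q0 l0 aT; rewrite /distribution.
have q0' : 0 < q%:R :> R by rewrite ltr0n.
have le1 : trunc_value l *+ q <= n *+ q by rewrite lerMn2r trunc_value_le orbT.
have e0 : 0 <= trunc_value l *+ q by rewrite mulrn_wge0.
rewrite [X in mu X](_ : _ = [set x | a < r x < a + trunc_value l *+ q]).
  rewrite (rank_slab rk) ?[a + _ - _]addrAC ?subrr ?add0r//.
  - by apply: (valuesD rk) => //; apply: VMn; exact: V_trunc_value.
  - by rewrite a0 lerDl.
  - by apply: le_trans aT; rewrite lee_fin lerD2l.
apply/seteqP; split => x /=;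
  rewrite ger0_norm ?rearr_on_ge0// lt_rearr_on ?invr_gt0// bnd_simp.
  move=> /and3P[-> xb]; rewrite /trunc_value; case: ifP => // h.
  have fD : D l \is a fin_num.
    by rewrite ge0_fin_numE// (lt_trans h)// ltry.
  by rewrite -[D l]fineK// lte_fin ltr_pdivrMl// ltrBlDl mulr_natl.
move=> /andP[-> xb]; rewrite (lt_le_trans xb) ?lerD2l//=.
move: xb; rewrite -ltrBlDl -[trunc_value l *+ q]mulr_natl -ltr_pdivrMl// /trunc_value.
case: ifP => h xb; last by apply: lt_le_trans (_ : n%:E <= _)%E; rewrite ?lte_fin// leNgt h.
by rewrite -[D l]fineK ?lte_fin// ge0_fin_numE// (lt_trans h)// ltry.
Qed.

Let slab j := rearr_on (BLeft (n *+ j + n *+ 1)) (n *+ j) 1%:R^-1.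

Let slab_bound j : (j < 4)%N -> ((n *+ j + n *+ 1)%:E <= mu [set: T])%E.
Proof.
move=> j4; apply: le_trans (cutoff_total rk k).
by rewrite lee_fin mulr_natl -mulrnDr addn1 ler_wpMn2l.
Qed.

Let mslab j : measurable_fun [set: T] (slab j).
Proof. by apply: measurable_rearr_on; rewrite invr1. Qed.

Let slabP j : (j < 4)%N -> X (slab j) /\ fnorm X (slab j) <= fnorm X f.
Proof.
move=> j4; have [Xh hf] := rearr_on_equimeasurable.
have [Xs s0f] : X (slab 0) /\ fnorm X (slab 0) <= fnorm X f.
  rewrite -hf; apply: (bi_ideal bX) => //; apply: aeW => x.
  rewrite !ger0_norm ?rearr_on_ge0// /slab/rearr_on mulr0n subr0 invr1.
  by case: (ltP 0 (r x)) => //= _; case: ifP => // _; exact: rearr_ge0.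
have [] := sX.2 (slab 0) (slab j) Xs (mslab j).
  move=> l l0; rewrite -![mu _]/(distribution mu _ l).
  rewrite !distribution_rearr_on//;
    [exact: VMn (cutoff_values rk k)|by rewrite mulrn_wge0|exact: slab_bound|
     exact: VMn (cutoff_values rk k)|exact: slab_bound].
by move=> Xj ->.
Qed.

(** Sum of [m] translates of the cut rearrangement on consecutive slabs. *)
Fixpoint slabs m : T -> R :=
  if m is j.+1 then slabs j \+ slab j else fun=> 0.

Let slabsP m : (m <= 4)%N -> [/\ X (slabs m), fnorm X (slabs m) <= m%:R * fnorm X f,
  forall x, slabs m x <> 0 -> r x < n *+ m &
  forall l, 0 <= l -> distribution mu (slabs m) l = (trunc_value l *+ m)%:E].
Proof.
elim: m => [_|m IH m4] /=.
  have [X0 n0'] : X (fun=> 0 : R) /\ fnorm X (fun=> 0 : R) <= 0 * fnorm X f.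
    have -> : (fun=> 0 : R) = (fun x => 0 * f x) by apply/funext => x; rewrite mul0r.
    by split; [exact: (bi_scale bX)|rewrite (bi_normZ bX)// normr0].
  split => // l l0; rewrite mulr0n /distribution (_ : [set x | _] = set0) ?measure0//.
  by apply/seteqP; split => x //=; rewrite normr0 ltNge l0.
have [Xm nm sm dm] := IH (ltnW m4).
have [Xs ns] := slabP m4.
have disj x : slabs m x = 0 \/ slab m x = 0.
  have [|/eqP/sm xm] := eqVneq (slabs m x) 0; first by left.
  by right; rewrite /slab /rearr_on ltNge (ltW xm).
split; first exact: (bi_add bX).
- apply: (le_trans (bi_normD bX Xm Xs)); rewrite -natr1 mulrDl mul1r.
  exact: lerD.
- move=> x; have [e|/eqP h] := eqVneq (slabs m x) 0.
    rewrite e add0r /slab/rearr_on; case: ifP => // /andP[_].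
    by rewrite bnd_simp -mulrnDr addn1.
  move=> _; apply: lt_le_trans (sm _ h) _.
  by rewrite ler_wpMn2l.
- move=> l l0; rewrite distribution_disjoint//; last exact: (bi_measurable bX).
  rewrite dm// distribution_rearr_on ?slab_bound// ?mulrn_wge0//.
    by rewrite -EFinD -mulrnDr addn1.
  exact: VMn (cutoff_values rk k).
Qed.

(** The level set at [l] has measure [trunc_value l *+ 4] for the cut dilation
    and for the sum of four translates alike. *)
Lemma cutoff_dilation :
  X (rearr_on (BLeft (0 + n *+ 4)) 0 4^-1) /\
  fnorm X (rearr_on (BLeft (0 + n *+ 4)) 0 4^-1) <= 4 * fnorm X f.
Proof.
have [X4 n4 _ d4] := slabsP (leqnn 4).
have [] := sX.2 _ (rearr_on (BLeft (0 + n *+ 4)) 0 4^-1) X4.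
- by apply: measurable_rearr_on; rewrite invr_gt0.
- move=> l l0; rewrite -![mu _]/(distribution mu _ l) d4//.
  rewrite distribution_rearr_on//; first exact: values0 rk.
  by rewrite add0r -mulr_natl; exact: cutoff_total rk k.
- by move=> ? ->.
Qed.

End cutoff.

Hypothesis fX : fatou_property mu X.

(** The cut dilations increase to the full one and eventually agree with it at
    almost every point. *)
Lemma dilation_bounded :
  X (rearr_on +oo%O 0 4^-1) /\ fnorm X (rearr_on +oo%O 0 4^-1) <= 4 * fnorm X f.
Proof.
pose u k := rearr_on (BLeft (0 + N k *+ 4)) 0 4^-1.
have uX k := cutoff_dilation k.
have h4 : 0 < 4^-1 :> R by rewrite invr_gt0.
have [] := fX (u := u) (measurable_rearr_on +oo%O 0 h4).
- by move=> k; have [] := uX k.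
- apply: filterS (cutoff_exhaust rk) => x [k0 xk0].
  have nd : nondecreasing_seq (fun n => u n x).
    move=> i j ij; rewrite /u /rearr_on; case: ltP => //= _.
    rewrite !bnd_simp !add0r.
    case: ifP => xi; case: ifP => xj //; last exact: rearr_ge0.
    have := cutoff_mono rk ij; rewrite -(ler_pMn2r (n:=4))// => /(lt_le_trans xi).
    by rewrite xj.
  split => //; first by move=> n; exact: rearr_on_ge0.
  apply: cvg_near_cst; near=> n.
  have k0n : (k0 <= n)%N by near: n; exact: nbhs_infty_ge.
  rewrite /u /rearr_on bnd_simp add0r -[N n *+ 4]mulr_natl.
  by rewrite (lt_le_trans xk0)// ler_pM2l// (cutoff_mono rk k0n).
- by exists (4 * fnorm X f) => k; have [] := uX k.
- move=> Xg _ cg; split => //.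
  rewrite -(cvg_lim _ cg)//; apply: limr_le; first by apply/cvg_ex; eexists; exact: cg.
  by apply: nearW => k; have [] := uX k.
Unshelve. all: by end_near. Qed.

End one_function.

(** The level set of [|f|] at the rearrangement of [f] at [r x / 4] has
    measure at most [r x / 4]. *)
Theorem symmetric_monotone_control X :
  symmetric_space mu X -> fatou_property mu X -> monotone_control mu r X.
Proof.
move=> sX fX; exists 4 => // f Xf nf.
have bX := sX.1.
have mf := bi_measurable bX Xf.
have ffin := symmetric_distribution_finite sX Xf.
have [Xg ng] := dilation_bounded sX Xf fX.
exists (rearr_on f +oo%O 0 4^-1); split => //.
- by apply: (le_trans ng); rewrite ler_piMr.
- apply: filterS (rank_gt0 rk) => x x0; apply: aeW => y xy.
  rewrite ger0_norm ?rearr_on_ge0// /rearr_on x0 (lt_le_trans x0 xy)/= !subr0.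
  by apply: rearr_nonincreasing => //; [rewrite mulr_gt0|rewrite ler_pM2l].
- apply: filterS (rank_gt0 rk) => x x0.
  apply: (@le_trans _ _ (distribution mu f (rearr_on f +oo%O 0 4^-1 x))).
    apply: le_measure; rewrite ?inE; last by move=> t [].
    - exact: measurableI (measurable_window _ _ mr) (measurable_abs_superlevel _ mf).
    - exact: measurable_abs_superlevel.
  rewrite leNgt /rearr_on x0/= subr0 mulrC -lt_rearr ?ltxx//.
  - exact: rearr_ge0.
  - by rewrite mulr_gt0.
Qed.

End symmetric_control.

(** * Spaces on which averages and tails are bounded *)

Section averaging.
Context (d : measure_display) (T : measurableType d) (R : realType).
Variables (mu : {measure set T -> \bar R}) (r : T -> R).
Implicit Types (X : fspace T R) (f g : T -> R).

Lemma cst_le_integral (D : set T) (c : \bar R) (f : T -> \bar R) :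
  measurable D -> (0 <= c)%E -> measurable_fun D f ->
  (forall x, D x -> (c <= f x)%E) -> (c * mu D <= \int[mu]_(x in D) f x)%E.
Proof.
move=> mD c0 mf cf; rewrite -integral_cst//; exact: ge0_le_integral.
Qed.

Lemma integral_le_cst (D : set T) (c : \bar R) (f : T -> \bar R) :
  measurable D -> measurable_fun D f -> (forall x, D x -> (0 <= f x)%E) ->
  (forall x, D x -> (f x <= c)%E) -> (\int[mu]_(x in D) f x <= c * mu D)%E.
Proof.
move=> mD mf f0 fc; rewrite -integral_cst//; exact: ge0_le_integral.
Qed.

Variable q : T -> R.

(* [averages] and [tail_integral] are the Cesaro operator and its dual when
   [q x] is the measure of the points of rank at most [r x]. *)

Definition head_integral f x : \bar R :=
  (\int[mu]_(t in [set t | (r t <= r x)%R]) (f t)%:E)%E.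

Definition tail_integral f x : \bar R :=
  (\int[mu]_(t in [set t | (r x <= r t)%R]) (f t / q t)%:E)%E.

Definition averages f x : R := (q x)^-1 * fine (head_integral f x).

Definition averaging_bounded X : Prop := exists K : R,
  forall f, X f -> (forall x, 0 <= f x) ->
    [/\ \forall x \ae mu, head_integral f x \is a fin_num,
        X (averages f) & fnorm X (averages f) <= K * fnorm X f].

Definition tail_bounded X : Prop := exists K : R,
  forall f, X f -> (forall x, 0 <= f x) ->
    [/\ \forall x \ae mu, tail_integral f x \is a fin_num,
        X (fine \o tail_integral f) &
        fnorm X (fine \o tail_integral f) <= K * fnorm X f].

(** The point [x'] stands for [x/4]: it precedes the window at [x], and the
    initial segment up to it is at least a quarter of the one up to [x]. *)
Record averaging_weight : Prop := AveragingWeight {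
  weight_rank_measurable : measurable_fun [set: T] r ;
  weight_measurable : measurable_fun [set: T] q ;
  weight_ge0 : forall x, 0 <= q x ;
  weight_mono : forall x y, r x <= r y -> q x <= q y ;
  weight_spec : \forall x \ae mu,
    [/\ 0 < q x, q x <= 2 * r x, mu [set t | r t <= r x] = (q x)%:E &
      exists x', [/\ r x' <= r x, forall t, r x / 4 <= r t -> r x' <= r t,
        mu [set t | r t <= r x'] = (q x')%:E & q x <= 4 * q x']] }.

Hypothesis wq : averaging_weight.
Let mr := weight_rank_measurable wq.
Let mq := weight_measurable wq.
Let q0 := weight_ge0 wq.

Let mhead x : measurable [set t | r t <= r x].
Proof.
rewrite [X in measurable X](_ : _ = r @^-1` `]-oo, r x]).
  exact: measurable_preimage_setT.
by apply/seteqP; split => t /=; rewrite in_itv.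
Qed.

Let mtail x : measurable [set t | r x <= r t].
Proof.
rewrite [X in measurable X](_ : _ = r @^-1` `[r x, +oo[).
  exact: measurable_preimage_setT.
by apply/seteqP; split => t /=; rewrite in_itv/= andbT.
Qed.

Let mslab x y : measurable [set t | r x < r t <= r y].
Proof.
rewrite [X in measurable X](_ : _ = r @^-1` `]r x, r y]).
  exact: measurable_preimage_setT.
by apply/seteqP; split => t /=; rewrite in_itv/=.
Qed.

Lemma measurable_averages f : measurable_fun [set: T] f ->
  (forall x, 0 <= f x) -> measurable_fun [set: T] (averages f).
Proof.
move=> mf f0; apply: measurable_funM; first exact: measurable_invr_ge0.
have mhf : measurable_fun [set: T] (head_integral f).
  apply: (@measurable_rank_antitone _ _ _ (fun x => - r x)).
    exact: measurable_funN.
  move=> x y; rewrite lerN2 => yx; apply: ge0_subset_integral => //.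
  - by apply: measurable_funS (_ : measurable_fun setT _) => //; apply/measurable_EFinP.
  - by move=> t _; rewrite lee_fin.
  - by move=> t /= /le_trans; apply.
exact: measurableT_comp.
Qed.

Lemma measurable_tail_integral f : measurable_fun [set: T] f ->
  (forall x, 0 <= f x) -> measurable_fun [set: T] (fine \o tail_integral f).
Proof.
move=> mf f0; apply: measurableT_comp => //.
apply: measurable_rank_antitone mr _ => x y xy; apply: ge0_subset_integral => //.
- apply: measurable_funS (_ : measurable_fun setT _) => //; apply/measurable_EFinP.
  by apply: measurable_funM => //; exact: measurable_invr_ge0.
- by move=> t _; rewrite lee_fin divr_ge0.
- by move=> t /=; exact: le_trans.
Qed.

Lemma averaging_bounded_operator X (A : operator T R) : banach_ideal mu X ->
  (forall f, measurable_fun [set: T] f -> (forall x, 0 <= f x) -> defined A f ->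
     \forall x \ae mu, head_integral f x \is a fin_num /\
       apply A f x = averages f x) ->
  bounded_on A X -> averaging_bounded X.
Proof.
move=> bX hA [K hK]; exists K => f Xf f0.
have [df XA nA] := hK _ Xf.
have hAf := hA f (bi_measurable bX Xf) f0 df.
have [] := bi_ideal bX (measurable_averages (bi_measurable bX Xf) f0) XA.
  by apply: filterS hAf => x [_ ->].
move=> Xa na; split => //; last exact: le_trans na nA.
by apply: filterS hAf => x [].
Qed.

Lemma tail_bounded_operator X (A : operator T R) : banach_ideal mu X ->
  (forall f, measurable_fun [set: T] f -> (forall x, 0 <= f x) -> defined A f ->
     \forall x \ae mu, tail_integral f x \is a fin_num /\
       apply A f x = fine (tail_integral f x)) ->
  bounded_on A X -> tail_bounded X.
Proof.
move=> bX hA [K hK]; exists K => f Xf f0.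
have [df XA nA] := hK _ Xf.
have hAf := hA f (bi_measurable bX Xf) f0 df.
have [] := bi_ideal bX (measurable_tail_integral (bi_measurable bX Xf) f0) XA.
  by apply: filterS hAf => x [_ ->].
move=> Xa na; split => //; last exact: le_trans na nA.
by apply: filterS hAf => x [].
Qed.

Section one_function.
Variable F : T -> R.
Hypotheses (mF : measurable_fun [set: T] F) (F0 : forall x, 0 <= F x).

Let mFq : measurable_fun [set: T] (fun t => (F t / q t)%:E).
Proof.
apply/measurable_EFinP; apply: measurable_funM => //.
exact: measurable_invr_ge0.
Qed.

Let Fq0 t : (0 <= (F t / q t)%:E)%E.
Proof. by rewrite lee_fin divr_ge0. Qed.

Let H := tail_integral F.

Let H0 x : (0 <= H x)%E. Proof. exact: integral_ge0. Qed.

Let Hanti x y : r x <= r y -> (H y <= H x)%E.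
Proof.
move=> xy; apply: ge0_subset_integral => //.
  exact: measurable_funS mFq.
by move=> t /=; exact: le_trans.
Qed.

Let mH : measurable_fun [set: T] H.
Proof. exact: measurable_rank_antitone mr Hanti. Qed.

Let h := fine \o H.
Let h0 x : 0 <= h x. Proof. exact: fine_ge0. Qed.
Let mh : measurable_fun [set: T] (EFin \o h).
Proof. by apply/measurable_EFinP; exact: measurableT_comp. Qed.

Hypothesis Hfin : \forall x \ae mu, H x \is a fin_num.
Hypothesis hfin : \forall x \ae mu, head_integral h x \is a fin_num.

Let hanti x y : H x \is a fin_num -> r x <= r y -> h y <= h x.
Proof.
move=> fx xy; rewrite fine_le ?Hanti// ge0_fin_numE//.
by apply: le_lt_trans (Hanti xy) _; rewrite ltey_eq fx.
Qed.

(* Tails may be infinite at exceptional points, where [h] is 0 instead; this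
   is invisible under the integral. *)
Let head_h x : head_integral h x = (\int[mu]_(t in [set t | (r t <= r x)%R]) H t)%E.
Proof.
apply: ge0_ae_eq_integral => //.
- exact: measurable_funS mh.
- exact: measurable_funS mH.
- by move=> t _; rewrite lee_fin.
- by apply: filterS Hfin => t ft _; rewrite /h/= fineK.
Qed.

Let G := averages h.

(** Passing from [x] to [y] adds to the mean values at most [h x], while the
    mean up to [x] is at least [h x]. *)
Lemma averages_antitone :
  \forall x \ae mu, \forall y \ae mu, r x <= r y -> `|G y| <= G x.
Proof.
apply: filterS3 (weight_spec wq) Hfin hfin => x [qx0 _ qx _] Hx hx.
apply: filterS3 (weight_spec wq) Hfin hfin => y [qy0 _ qy _] Hy hy xy.
have Ix0 z : (0 <= head_integral h z)%E.
  by apply: integral_ge0 => t _; rewrite lee_fin.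
rewrite ger0_norm; last by rewrite mulr_ge0 ?invr_ge0// fine_ge0.
have hUx : [set t | r t <= r y] = [set t | r t <= r x] `|` [set t | r x < r t <= r y].
  apply/seteqP; split => t /=.
    by case: (leP (r t) (r x)) => [?|? ->]; [left|right].
  by case=> [/le_trans|/andP[_]]//; apply.
have AB0 : [set t | r t <= r x] `&` [set t | r x < r t <= r y] = set0.
  by apply/seteqP; split => t //= [tx /andP[]]; rewrite ltNge tx.
have mus : mu [set t | r x < r t <= r y] = (q y - q x)%:E.
  move: qy; rewrite hUx measureU//.
  move=> qy'; have : ((q x)%:E + mu [set t | (r x < r t <= r y)%R] = (q y)%:E)%E.
    by rewrite -qx.
  by rewrite EFinB => <-; rewrite addeAC subee// add0e.
have I1 : (head_integral h y <= head_integral h x + (h x * (q y - q x))%:E)%E.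
  rewrite /head_integral hUx ge0_integral_setU//.
  - rewrite leeD2l// EFinM -mus; apply: integral_le_cst => //.
    + exact: measurable_funS mh.
    + by move=> t _; rewrite lee_fin.
    + by move=> t /= /andP[/ltW xt _]; rewrite lee_fin hanti.
  - exact: measurable_funS mh.
  - by move=> t _; rewrite lee_fin.
  - by apply/disj_setPS; rewrite AB0.
have I2 : ((h x * q x)%:E <= head_integral h x)%E.
  rewrite EFinM -qx head_h; apply: cst_le_integral => //.
  - by rewrite lee_fin.
  - exact: measurable_funS mH.
  - by move=> t /= tx; rewrite /h/= fineK// Hanti.
move: I1 I2; rewrite /G /averages.
rewrite -(fineK hx) -(fineK hy) -EFinD !lee_fin /=.
move: (fine (head_integral h x)) (fine (head_integral h y)) => a b.
have qxy : q x <= q y by exact: (weight_mono wq).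
move=> ba ha; rewrite ler_pdivrMl// mulrA [_ * (q x)^-1]mulrC -mulrA ler_pdivlMl//.
by have := h0 x; nra.
Qed.

(** Since [H] is nonincreasing, [H z * q z <= q x * G x] for the point [z]
    standing for [x/4], so [H z <= 4 * G x].  On the bad set
    [F t / q t >= 32 * G x / q x], and the integral of [F / q] there is at most
    [H z]; hence the bad set has measure at most [q x / 8 <= r x / 4].  If
    [G x = 0], the integral vanishes and the bad set is null. *)
Lemma averages_control : \forall x \ae mu,
  (mu [set t | (r x / 4 <= r t <= r x)%R /\ (32 * G x < F t)%R] <=
   (r x / 4)%:E)%E.
Proof.
apply: filterS2 (weight_spec wq) hfin => x [qx0 q2r qx [z [zx zW qz q4]]] hx.
have qz0 : 0 < q z by lra.
have G0 : 0 <= G x by rewrite mulr_ge0 ?invr_ge0// fine_ge0// integral_ge0// => t _; rewrite lee_fin.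
have HG : (H z <= (4 * G x)%:E)%E.
  have : (H z * (q z)%:E <= (q x * G x)%:E)%E.
    rewrite /G /averages mulVKf ?gt_eqF// fineK// head_h -qz.
    apply: le_trans (_ : \int[mu]_(t in [set t | (r t <= r z)%R]) H t <= _)%E.
      apply: cst_le_integral => //; first exact: measurable_funS mH.
      by move=> t; exact: Hanti.
    apply: ge0_subset_integral => //; first exact: measurable_funS mH.
    by move=> t /= /le_trans; apply.
  rewrite muleC -lee_pdivlMl// => /le_trans; apply.
  by rewrite -EFinM lee_fin mulrA ler_wpM2r// ler_pdivrMl// mulrC.
set A := [set t | _].
have mA : measurable A.
  exact: measurableI (measurable_window _ _ mr) (measurable_superlevel _ mF).
have qt t : A t -> 0 < q t <= q x.
  move=> [/andP[/zW zt tx] _].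
  by rewrite (lt_le_trans qz0) ?(weight_mono wq).
have AH : (\int[mu]_(t in A) (F t / q t)%:E <= H z)%E.
  apply: ge0_subset_integral => //; first exact: measurable_funS mFq.
  by move=> t [/andP[/zW]].
have mFA : measurable_fun A (fun t => (F t / q t)%:E) by exact: measurable_funS mFq.
have [Gx|Gx] := ltP 0 (G x); last first.
  have G00 : G x = 0 by apply/eqP; rewrite eq_le Gx.
  have : (\int[mu]_(t in A) `|(F t / q t)%:E| = 0)%E.
    under eq_integral do rewrite gee0_abs//.
    apply/eqP; rewrite eq_le integral_ge0// andbT.
    by rewrite (le_trans AH)// (le_trans HG)// G00 mulr0.
  move/(ae_eq_integral_abs mu mA mFA) => -[Z [mZ Z0 hZ]].
  have : (mu A <= mu Z)%E.
    apply: le_measure; rewrite ?inE// => t At; apply: hZ => /= /(_ At) [] /eqP.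
    have [_] := At; rewrite G00 mulr0 => Ft; have /andP[qt0 _] := qt t At.
    by rewrite gt_eqF// divr_gt0.
  rewrite (Z0 : mu Z = 0%E) => /le_trans; apply; rewrite lee_fin; lra.
have Gq0 : 0 < 32 * G x / q x by rewrite divr_gt0// mulr_gt0.
have : ((32 * G x / q x)%:E * mu A <= (4 * G x)%:E)%E.
  apply: le_trans (le_trans AH HG); apply: cst_le_integral => //.
    by rewrite lee_fin ltW.
  move=> t At; have /andP[qt0 qtx] := qt t At.
  have [_ /ltW Ft] := At.
  rewrite lee_fin ler_pM ?invr_ge0 ?(ltW qx0)//; first exact: mulr_ge0.
  by rewrite lef_pV2.
rewrite -lee_pdivlMl// => /le_trans; apply; rewrite -EFinM lee_fin.
have -> : (32 * G x / q x)^-1 * (4 * G x) = q x / 8.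
  by field; rewrite !gt_eqF.
lra.
Qed.

End one_function.

Theorem averaging_monotone_control X : banach_ideal mu X ->
  averaging_bounded X -> tail_bounded X -> monotone_control mu r X.
Proof.
move=> bX [K1 avg] [K2 tl].
pose K := 32 * `|K1| * `|K2| + 1.
have K0 : 0 < K by rewrite ltr_wpDl// mulr_ge0// mulr_ge0.
exists K => // f Xf nf.
have mf := bi_measurable bX Xf.
have mF : measurable_fun [set: T] (fun x => `|f x|) by exact: measurableT_comp.
have F0 x : 0 <= `|f x| by [].
have [XF nF] : X (fun x => `|f x|) /\ fnorm X (fun x => `|f x|) <= fnorm X f.
  by apply: (bi_ideal bX) => //; apply: aeW => x; rewrite normr_id.
have [Hfin Xh nh] := tl _ XF F0.
have h0 x : 0 <= (fine \o tail_integral (fun x => `|f x|)) x.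
  rewrite /= fine_ge0// integral_ge0// => t _; rewrite lee_fin.
  by rewrite divr_ge0.
have [hfin XG nG] := avg _ Xh h0.
exists (fun x => 32 * averages (fine \o tail_integral (fun x => `|f x|)) x).
split.
- exact: (bi_scale bX).
- rewrite (bi_normZ bX)// ger0_norm//.
  have p0 := fnorm_ge0 bX Xh; have p1 := fnorm_ge0 bX XF; have p2 := fnorm_ge0 bX XG.
  have a1 := ler_norm K1; have a2 := ler_norm K2.
  have b1 : fnorm X (fine \o tail_integral (fun x => `|f x|)) <= `|K2|.
    by apply: (le_trans nh); have := normr_ge0 K2; nra.
  rewrite /K -mulrA; apply: ler_wpDr => //; rewrite ler_pM2l//.
  apply: (le_trans nG); apply: le_trans (_ : `|K1| * fnorm X (fine \o tail_integral (fun x => `|f x|)) <= _).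
    by rewrite ler_wpM2r.
  by rewrite ler_wpM2l.
- have := averages_antitone mF F0 Hfin hfin.
  apply: filterS => x; apply: filterS => y h /h {}h.
  by rewrite normrM ger0_norm// ler_pM2l.
- exact: averages_control mF F0 Hfin hfin.
Qed.

End averaging.

(** * Intervals *)

Section interval.
Context (R : realType) (J : set (measurableTypeR R)) (mJ : measurable J).
Hypothesis J_ge0 : forall x, J x -> 0 <= x.
Hypothesis J_down : forall x y : R, J y -> 0 <= x <= y -> J x.
Local Notation leb := (@lebesgue_measure R).
Local Notation mu := (itv_measure mJ).

Lemma itv_measureE A : mu A = leb (A `&` J). Proof. by []. Qed.

Lemma ae_itv_measure (P : R -> Prop) :
  (\forall x \ae mu, P x) <-> (\forall x \ae leb, J x -> P x).
Proof.
split => [[N [mN N0 hN]]|[N [mN N0 hN]]].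
  exists (N `&` J); split => //; first exact: measurableI.
  by move=> x /= /not_implyP[Jx nP]; split => //; exact: hN.
exists (N `|` ~` J); split.
- by apply: measurableU => //; exact: measurableC.
- rewrite itv_measureE setIUl setICl setU0.
  by apply: subset_measure0 N0 => //; exact: measurableI.
- move=> x /= nP; have [Jx|] := pselect (J x); last by right.
  by left; apply: hN => /= /(_ Jx).
Qed.

Lemma ae_itv_gt0 (P : R -> Prop) :
  (forall x, J x -> 0 < x -> P x) -> \forall x \ae mu, P x.
Proof.
move=> h; apply/ae_itv_measure; exists [set 0]; split => //.
  exact: lebesgue_measure_set1.
move=> x /= /not_implyP[Jx nP]; apply/eqP/negPn/negP => x0.
by apply: nP; apply: h => //; rewrite lt_neqAle eq_sym x0/= J_ge0.
Qed.

Lemma integral_itv_measure (D : set R) (f : R -> \bar R) :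
  measurable D -> measurable_fun [set: measurableTypeR R] f ->
  (forall x, (0 <= f x)%E) ->
  (\int[mu]_(x in D) f x = \int[leb]_(x in D `&` J) f x)%E.
Proof.
move=> mD mf f0; rewrite (ge0_negligible_integral (N := ~` J))//.
- rewrite setDE setCK; apply: eq_measure_integral => A mA AJ.
  rewrite [LHS]itv_measureE; congr (leb _); apply/setIidPl => x /AJ[].
  by [].
- exact: measurableC.
- exact: measurable_funS mf.
- by rewrite itv_measureE setICl measure0.
Qed.

Lemma itv_majorantP : is_majorant mu (fun x => x) (@itv_majorant R J).
Proof.
split => [f x|f x c c0].
  apply: ess_sup_gee.
    apply: (@lt_le_trans _ _ (leb `[0, 1])); last by rewrite le_measure ?inE.
    by rewrite lebesgue_measure_itv/= lte01 sube0 lte01.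
  by apply: aeW => t; rewrite patchE; case: ifP.
rewrite ae_itv_measure; split.
  move=> /ess_supP; apply: filterS => y; rewrite patchE.
  case: ifPn => [_ + _ _|]; first by rewrite lee_fin.
  rewrite notin_setE /= in_itv/= andbT => h _ Jy xy; exfalso; apply: h.
  by split.
move=> h; apply/ess_supP; apply: filterS h => y h.
rewrite patchE; case: ifPn; last by rewrite lee_fin.
by rewrite inE/= in_itv/= andbT => -[Jy xy]; rewrite lee_fin h.
Qed.

(** The bound on [b] keeps the open interval inside [J]. *)
Lemma itv_measure_oo (a b : R) : 0 <= a <= b -> (b%:E <= leb J)%E ->
  mu [set x | a < x < b] = (b - a)%:E.
Proof.
move=> /andP[a0 ab] bJ; rewrite itv_measureE.
rewrite (_ : _ `&` _ = `]a, b[%classic).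
  by rewrite lebesgue_measure_itv/= lte_fin; case: ltP => // ba; congr EFin; lra.
apply/seteqP; split => x /=; rewrite in_itv/=; first by case.
move=> /andP[ax xb]; split; first by rewrite ax.
have x0 : 0 <= x by exact: le_trans a0 (ltW ax).
apply: contrapT => nJ.
suff : (leb J <= x%:E)%E by move=> /(le_trans bJ); rewrite lee_fin leNgt xb.
have -> : x%:E = leb `[0, x].
  by rewrite lebesgue_measure_itv/= lte_fin; case: ltP => [_|x0']; rewrite ?sube0//; congr EFin; lra.
apply: le_measure; rewrite ?inE// => y Jy /=; rewrite in_itv/= J_ge0//=.
rewrite leNgt; apply/negP => xy; apply: nJ; apply: (J_down Jy).
by rewrite x0 ltW.
Qed.

Lemma itv_measure_cc (a b : R) : J b -> 0 <= a <= b ->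
  mu [set x | a <= x <= b] = (b - a)%:E.
Proof.
move=> Jb /andP[a0 ab]; rewrite itv_measureE (_ : _ `&` _ = `[a, b]%classic).
  by rewrite lebesgue_measure_itv/= lte_fin; case: ltP => // ba; congr EFin; lra.
apply/seteqP; split => x /=; rewrite in_itv/=; first by case.
move=> /andP[ax xb]; split; first by rewrite ax.
by apply: (J_down Jb); rewrite (le_trans a0 ax).
Qed.

Lemma itv_measure_head x : J x -> mu [set t | t <= x] = x%:E.
Proof.
move=> Jx; have x0 := J_ge0 Jx; rewrite -[x in RHS]subr0.
rewrite -(itv_measure_cc Jx) ?lexx ?x0// !itv_measureE; congr (leb _).
apply/seteqP; split => t /= [tx Jt]; split => //; last by have /andP[] := tx.
by rewrite tx J_ge0.
Qed.

Lemma itv_window : \forall x \ae mu, 0 < x /\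
  ((3 / 4 * x)%:E <= mu [set t | (x / 4 <= t <= x)%R])%E.
Proof.
apply: ae_itv_gt0 => x Jx x0; split => //.
by rewrite itv_measure_cc// ?lee_fin; lra.
Qed.

Lemma itv_rank_function (N : nat -> R) : (forall k, 0 <= N k) ->
  nondecreasing_seq N -> (forall k, ((4 * N k)%:E <= leb J)%E) ->
  (\forall x \ae mu, exists k, x < 4 * N k) ->
  rank_function mu (fun x => x) [set: R] N.
Proof.
move=> N0 Nmono NJ Nex.
have muT : mu setT = leb J by rewrite itv_measureE setTI.
split => //.
- exact: ae_itv_gt0.
- by move=> a b _ _ ab bJ; apply: itv_measure_oo => //; rewrite -muT.
- by move=> k; rewrite muT.
Qed.

(** Functions live on the whole line, so the weight [x] is truncated at 0 to be
    nonnegative and nondecreasing everywhere. *)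
Lemma itv_averaging_weight : averaging_weight mu (fun x => x) (fun x => Num.max x 0).
Proof.
split.
- exact: measurable_id.
- apply: nondecreasing_measurable => // x y xy; rewrite ge_max !le_max.
  by rewrite xy lexx !orbT.
- by move=> x; rewrite le_max lexx orbT.
- by move=> x y xy; rewrite ge_max !le_max xy lexx !orbT.
- apply: ae_itv_gt0 => x Jx x0.
  have x4 : 0 <= x / 4 <= x by lra.
  rewrite max_l ?(ltW x0)//; split => //; first lra.
    exact: itv_measure_head.
  exists (x / 4); rewrite max_l; [|by case/andP: x4]; split => //.
  + by case/andP: x4.
  + by apply: itv_measure_head; exact: J_down Jx x4.
  + lra.
Qed.

Let q (x : R) := Num.max x 0.

Let integrable_ge0 (D : set (measurableTypeR R)) (f : R -> R) :
  (forall x, D x -> 0 <= f x) -> leb.-integrable D (EFin \o f) ->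
  (\int[leb]_(x in D) (f x)%:E)%E \is a fin_num.
Proof.
move=> f0 /integrableP[mf If]; rewrite ge0_fin_numE.
  apply: le_lt_trans If; rewrite le_eqVlt; apply/orP; left; apply/eqP.
  by apply: eq_integral => x /set_mem Dx /=; rewrite ger0_norm ?f0.
by apply: integral_ge0 => x Dx; rewrite lee_fin f0.
Qed.

Lemma itv_cesaro_averages (f : measurableTypeR R -> R) :
  measurable_fun [set: measurableTypeR R] f ->
  (forall x, 0 <= f x) -> defined (itv_cesaro mJ) f ->
  \forall x \ae mu, head_integral mu (fun x => x) f x \is a fin_num /\
    apply (itv_cesaro mJ) f x = averages mu (fun x => x) q f x.
Proof.
move=> mf f0 /= /ae_itv_measure df; apply/ae_itv_measure.
apply: filterS df => x /[swap] Jx /(_ Jx) ifx.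
have x0 := J_ge0 Jx.
have E : head_integral mu (fun x => x) f x = (\int[leb]_(t in `[0%R, x]) (f t)%:E)%E.
  rewrite /head_integral integral_itv_measure//.
  - congr (\int[_]_(t in _) _)%E; apply/seteqP; split => t /=; rewrite in_itv/=.
      by move=> [tx Jt]; rewrite J_ge0.
    by move=> /andP[t0 tx]; split => //; apply: (J_down Jx); rewrite t0.
  - by rewrite (_ : [set t | _] = `]-oo, x]%classic).
  - exact/measurable_EFinP.
by rewrite /averages E /q max_l//; split => //; apply: integrable_ge0.
Qed.

Lemma itv_copson_tail (f : measurableTypeR R -> R) :
  measurable_fun [set: measurableTypeR R] f ->
  (forall x, 0 <= f x) -> defined (itv_copson mJ) f ->
  \forall x \ae mu, tail_integral mu (fun x => x) q f x \is a fin_num /\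
    apply (itv_copson mJ) f x = fine (tail_integral mu (fun x => x) q f x).
Proof.
move=> mf f0 /= /ae_itv_measure df; apply/ae_itv_measure.
apply: filterS df => x /[swap] Jx /(_ Jx) ifx.
have x0 := J_ge0 Jx.
have q0 t : 0 <= q t by rewrite /q le_max lexx orbT.
have E : tail_integral mu (fun x => x) q f x =
    (\int[leb]_(t in J `&` `[x, +oo[) (f t / t)%:E)%E.
  rewrite /tail_integral integral_itv_measure//.
  - rewrite (_ : _ `&` J = J `&` `[x, +oo[); last first.
      by apply/seteqP; split => t /=; rewrite in_itv/= andbT => -[].
    by apply: eq_integral => t /set_mem[Jt _]; rewrite /q max_l// J_ge0.
  - rewrite (_ : [set t | _] = `[x, +oo[%classic)//.
    by apply/seteqP; split => t /=; rewrite in_itv/= andbT.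
  - apply/measurable_EFinP; apply: measurable_funM => //.
    by apply: measurable_invr_ge0 => //; exact: (weight_measurable itv_averaging_weight).
  - by move=> t; rewrite lee_fin divr_ge0.
rewrite E; split => //; apply: integrable_ge0 => // t [Jt _].
by rewrite divr_ge0// J_ge0.
Qed.

Lemma itv_tandori_same N (phi : R -> R -> R)
    (X0 X1 : fspace (measurableTypeR R) R) :
  (forall k, 0 <= N k) -> nondecreasing_seq N ->
  (forall k, ((4 * N k)%:E <= leb J)%E) ->
  (\forall x \ae mu, exists k, x < 4 * N k) ->
  banach_ideal mu X0 -> banach_ideal mu X1 ->
  fatou_property mu X0 -> fatou_property mu X1 -> class_U phi ->
  (symmetric_space mu X0 /\ symmetric_space mu X1) \/
  ((bounded_on (itv_cesaro mJ) X0 /\ bounded_on (itv_copson mJ) X0) /\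
   (bounded_on (itv_cesaro mJ) X1 /\ bounded_on (itv_copson mJ) X1)) ->
  same_fspace
    (calderon_lozanovskii mu phi (tandori_of mu (@itv_majorant R J) X0)
      (tandori_of mu (@itv_majorant R J) X1))
    (tandori_of mu (@itv_majorant R J) (calderon_lozanovskii mu phi X0 X1)).
Proof.
move=> N0 Nmono NJ Nex bX0 bX1 fX0 fX1 phiU alt.
have rk := itv_rank_function N0 Nmono NJ Nex.
have ctrl X : banach_ideal mu X -> fatou_property mu X ->
    symmetric_space mu X \/
    (bounded_on (itv_cesaro mJ) X /\ bounded_on (itv_copson mJ) X) ->
    monotone_control mu (fun x => x) X.
  move=> bX fX [sX|[bC bC']]; first exact: (symmetric_monotone_control rk sX fX).
  apply: (averaging_monotone_control itv_averaging_weight bX).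
    exact: (averaging_bounded_operator itv_averaging_weight bX itv_cesaro_averages bC).
  exact: (tail_bounded_operator itv_averaging_weight bX itv_copson_tail bC').
apply: (calderon_lozanovskii_tandori_same (rank_measurable rk) itv_majorantP) => //.
- exact: itv_window.
- by apply: ctrl => //; case: alt => [[]|[]]; [left|right].
- by apply: ctrl => //; case: alt => [[]|[]]; [left|right].
Qed.

End interval.

(** * Sequences *)

Definition counting_measure (R : realType) : {measure set nat -> \bar R} :=
  @counting nat R.

Section sequences.
Variable R : realType.
Local Notation mu := (counting_measure R).

Lemma counting_measureE (A : set nat) : mu A = counting A. Proof. by []. Qed.


Lemma counting_set1 (n : nat) : mu [set n] = 1%E.
Proof.
by rewrite counting_measureE /counting asboolT// fset_set1 finmap.cardfs1.
Qed.

Lemma counting_segment (a b : nat) : (a <= b)%N ->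
  mu [set k | (a <= k < b)%N] = (b - a)%N%:R%:E.
Proof.
move=> /subnK <-; rewrite addnK addnC; elim: (b - a)%N => [|m IH].
  rewrite (_ : [set k | _] = set0) ?measure0//.
  by apply/seteqP; split => k //=; lia.
rewrite (_ : [set k | _] = [set k | (a <= k < a + m)%N] `|` [set (a + m)%N]).
  rewrite measureU//.
    by rewrite [X in (X + _)%E]IH [X in (_ + X)%E]counting_set1 -EFinD natr1.
  by apply/seteqP; split => k //= [+ kE]; lia.
apply/seteqP; split => k /=; first by have := eqVneq k (a + m)%N; case=> [->|]; [right|left; lia].
by case; lia.
Qed.

Lemma ae_counting (P : nat -> Prop) :
  (\forall n \ae mu, P n) <-> forall n, P n.
Proof.
split => [[N [_ N0 hN]] n|]; last exact: aeW.
apply: contrapT => nP; have Nn : N n by exact: hN.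
have : (mu [set k | (n <= k < n.+1)%N] <= mu N)%E.
  apply: le_measure; rewrite ?inE// => k /=.
  by rewrite ltnS -eqn_leq => /eqP <-.
by rewrite counting_segment// N0 subSnn lee_fin ler10.
Qed.

(* The shift by 1/2 keeps ranks away from the natural numbers: the open slab
   between two naturals [a <= b] then contains exactly [b - a] indices. *)
Let r (n : nat) : R := n%:R + 2^-1.
Let q (n : nat) : R := n.+1%:R.

Let le_r i j : (r i <= r j) = (i <= j)%N.
Proof. by rewrite /r lerD2r ler_nat. Qed.

Lemma seq_majorantP : is_majorant mu r (@seq_majorant R).
Proof.
split => [f n|f n c c0].
  by apply: (@le_trans _ _ `|f n|%:E); [rewrite lee_fin|apply: ereal_sup_ubound; exists n => /=].
rewrite ae_counting; split.
  move=> h k; rewrite le_r => nk; rewrite -lee_fin; apply: le_trans h.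
  by apply: ereal_sup_ubound; exists k.
move=> h; apply: ub_ereal_sup => _ [k /= nk <-].
by rewrite lee_fin h// le_r.
Qed.

Lemma counting_head n : mu [set t | r t <= r n] = (q n)%:E.
Proof.
rewrite (_ : [set t | _] = [set k | (0 <= k < n.+1)%N]).
  by rewrite counting_segment.
by apply/seteqP; split => t /=; rewrite le_r ltnS.
Qed.

(* the least index t with r n / 4 <= r t *)
Let quarter n := ((n + 2) %/ 4)%N.

Let quarterP n t : r n / 4 <= r t -> (quarter n <= t)%N.
Proof.
move=> h; rewrite -ltnS ltn_divLR//.
suff : (n < 4 * t + 2)%N by lia.
rewrite -(ltr_nat R) natrD natrM; move: h; rewrite /r; lra.
Qed.

Let quarter_le n : (4 * quarter n <= n + 2)%N && (n <= 4 * quarter n + 1)%N.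
Proof. by rewrite /quarter; apply/andP; split; lia. Qed.

Let quarter_leR n : 4 * (quarter n)%:R <= n%:R + 2 :> R /\
  n%:R <= 4 * (quarter n)%:R + 1 :> R.
Proof.
have /andP[h1 h2] := quarter_le n; split.
  by have := h1; rewrite -(ler_nat R) natrD natrM.
by have := h2; rewrite -(ler_nat R) natrD natrM.
Qed.

Lemma seq_window : \forall n \ae mu, 0 < r n /\
  ((3 / 4 * r n)%:E <= mu [set t | (r n / 4 <= r t <= r n)%R])%E.
Proof.
apply/ae_counting => n; split; first by rewrite /r ltr_wpDl.
have [h1 h2] := quarter_leR n; have /andP[h3 h4] := quarter_le n.
apply: (@le_trans _ _ (mu [set k | (quarter n <= k < n.+1)%N])).
  rewrite counting_segment; last by lia.
  rewrite lee_fin natrB; last by lia.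
  by rewrite -natr1 /r; lra.
apply: le_measure; rewrite ?inE// => k /=.
rewrite ltnS le_r => /andP[qk ->]; rewrite andbT.
by have := qk; rewrite -(ler_nat R) /r; lra.
Qed.

Lemma seq_rank_function :
  rank_function mu r (range (fun n : nat => n%:R))
    (fun n => n%:R).
Proof.
split => //.
- by apply/ae_counting => n; rewrite /r ltr_wpDl.
- by exists 0%N.
- by move=> _ _ [i _ <-] [j _ <-]; exists (i + j)%N; rewrite ?natrD.
- move=> A _; rewrite counting_measureE /counting; by case: ifP.
- move=> _ _ [i _ <-] [j _ <-]; rewrite ler0n/= ler_nat => ij _.
  rewrite (_ : [set t | _] = [set k | (i <= k < j)%N]).
    by rewrite counting_segment// natrB.
  apply/seteqP; split => k /=; rewrite /r => /andP[ik kj]; apply/andP; split.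
  + by rewrite -ltnS -(ltr_nat R) -natr1; lra.
  + by rewrite -(ltr_nat R); lra.
  + by move: ik; rewrite -(ler_nat R); lra.
  + by move: kj; rewrite -(ler_nat R) -natr1; lra.
- by move=> i j ij; rewrite ler_nat.
- by move=> k; rewrite counting_measureE /counting asboolF ?leey//; exact: infinite_nat.
- apply/ae_counting => n; exists n.+1; rewrite /r -[n.+1%:R]natr1.
  by have := ler0n R n; lra.
Qed.

Lemma seq_averaging_weight :
  averaging_weight mu r q.
Proof.
split => //.
- by move=> i j; rewrite le_r /q ler_nat ltnS.
- apply/ae_counting => n; split => //.
  + by rewrite /q /r -natr1; have := ler0n R n; lra.
  + exact: counting_head.
  + have [h1 h2] := quarter_leR n; have /andP[h3 h4] := quarter_le n.
    exists (quarter n); split.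
    * by rewrite le_r; lia.
    * by move=> t /quarterP; rewrite le_r.
    * exact: counting_head.
    * by rewrite /q -!natr1; lra.
Qed.

Let integral_counting (a : nat -> \bar R) (D : set nat) :
  (forall k, 0 <= a k)%E ->
  (\int[mu]_(k in D) a k = \sum_(k <oo | k \in D) a k)%E.
Proof.
move=> a0; rewrite integral_mkcond ge0_integral_count.
  rewrite [RHS]eseries_mkcond; apply: eq_eseriesr => k _.
  by rewrite patchE.
by move=> k; rewrite patchE; case: ifP.
Qed.

Lemma seq_cesaro_averages (a : nat -> R) : measurable_fun [set: nat] a ->
  (forall n, 0 <= a n) -> defined (@seq_cesaro R) a ->
  \forall n \ae mu, head_integral mu r a n \is a fin_num /\
    apply (@seq_cesaro R) a n = averages mu r q a n.
Proof.
move=> _ a0 _; apply/ae_counting => n.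
have E : head_integral mu r a n = (\sum_(0 <= k < n.+1) a k)%:E.
  rewrite /head_integral integral_counting; last by move=> k; rewrite lee_fin.
  rewrite eseries_mkcond (nneseries_split 0 n.+1); last first.
    by move=> k _; case: ifP; rewrite ?lee_fin.
  rewrite [X in (_ + X)%E]eseries0 ?adde0 => [|k nk _]; last first.
    by rewrite ifF//; apply/negbTE; rewrite notin_setE /= le_r; lia.
  rewrite -sumEFin add0n; apply: eq_big_nat => k /andP[_ kn].
  by rewrite ifT// inE/= le_r -ltnS.
by rewrite /averages E.
Qed.

Lemma seq_copson_tail (a : nat -> R) : measurable_fun [set: nat] a ->
  (forall n, 0 <= a n) -> defined (@seq_copson R) a ->
  \forall n \ae mu, tail_integral mu r q a n \is a fin_num /\
    apply (@seq_copson R) a n = fine (tail_integral mu r q a n).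
Proof.
move=> _ a0 ca; apply/ae_counting => n.
suff E : tail_integral mu r q a n =
    (\big[+%R/0]_(n <= k <oo) (a k / k.+1%:R))%:E by rewrite E.
rewrite /tail_integral integral_counting; last first.
  by move=> k; rewrite lee_fin divr_ge0.
rewrite -EFin_lim; last exact: ca.
rewrite (_ : EFin \o _ = (fun m => \sum_(n <= k < m) (a k / k.+1%:R)%:E)%E); last first.
  by apply/funext => m /=; rewrite sumEFin.
rewrite ereal_series; apply: eq_eseriesl => k.
by apply/idP/idP; rewrite inE/= le_r.
Qed.

Lemma seq_tandori_same (phi : R -> R -> R) (X0 X1 : fspace nat R) :
  banach_ideal mu X0 -> banach_ideal mu X1 ->
  fatou_property mu X0 -> fatou_property mu X1 -> class_U phi ->
  (symmetric_space mu X0 /\ symmetric_space mu X1) \/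
  ((bounded_on (@seq_cesaro R) X0 /\ bounded_on (@seq_copson R) X0) /\
   (bounded_on (@seq_cesaro R) X1 /\ bounded_on (@seq_copson R) X1)) ->
  same_fspace
    (calderon_lozanovskii mu phi (tandori_of mu (@seq_majorant R) X0)
      (tandori_of mu (@seq_majorant R) X1))
    (tandori_of mu (@seq_majorant R) (calderon_lozanovskii mu phi X0 X1)).
Proof.
move=> bX0 bX1 fX0 fX1 phiU alt.
have ctrl X : banach_ideal mu X -> fatou_property mu X ->
    symmetric_space mu X \/
    (bounded_on (@seq_cesaro R) X /\ bounded_on (@seq_copson R) X) ->
    monotone_control mu r X.
  move=> bX fX [sX|[bC bC']].
    exact: (symmetric_monotone_control seq_rank_function sX fX).
  apply: (averaging_monotone_control seq_averaging_weight bX).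
    exact: (averaging_bounded_operator seq_averaging_weight bX seq_cesaro_averages bC).
  exact: (tail_bounded_operator seq_averaging_weight bX seq_copson_tail bC').
apply: (calderon_lozanovskii_tandori_same (rank_measurable seq_rank_function)
  seq_majorantP) => //.
- exact: seq_window.
- by apply: ctrl => //; case: alt => [[]|[]]; [left|right].
- by apply: ctrl => //; case: alt => [[]|[]]; [left|right].
Qed.

End sequences.


(** * The commutation theorem *)

Theorem theorem4 (R : realType) (I : domain)
    (X0 X1 : fspace (pts (setting_of R I)) R) (phi : R -> R -> R) :
  let m := msr (setting_of R I) in
  let C := cesaro_op (setting_of R I) in
  let Cstar := copson_op (setting_of R I) in
  banach_ideal m X0 -> banach_ideal m X1 ->
  fatou_property m X0 -> fatou_property m X1 ->
  class_U phi ->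
  (symmetric_space m X0 /\ symmetric_space m X1) \/
  ((bounded_on C X0 /\ bounded_on Cstar X0) /\
   (bounded_on C X1 /\ bounded_on Cstar X1)) ->
  same_fspace (calderon_lozanovskii m phi (tandori X0) (tandori X1))
              (tandori (calderon_lozanovskii m phi X0 X1)).
Proof.
case: I X0 X1 => X0 X1 m C Cstar.
- apply: (@itv_tandori_same _ _ _ _ _ (fun=> 4^-1)) => //.
  + by move=> x /=; rewrite in_itv/= => /andP[].
  + by move=> x y /=; rewrite !in_itv/= => /andP[_ y1] /andP[-> xy]; rewrite (le_trans xy).
  + by move=> k; rewrite mulfV// lebesgue_measure_itv/= lte01 sube0.
  + apply/ae_itv_measure; exists [set 1]; split => //.
      exact: lebesgue_measure_set1.
    move=> x /= /not_implyP[]; rewrite in_itv/= => /andP[_ x1] h.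
    apply/eqP/negPn/negP => xn1; apply: h; exists 0%N.
    by rewrite mulfV// lt_neqAle xn1.
- apply: (@itv_tandori_same _ _ _ _ _ (fun k => k%:R)) => //.
  + by move=> x /=; rewrite in_itv/= andbT.
  + by move=> x y /=; rewrite !in_itv/= !andbT => _ /andP[].
  + by move=> i j ij; rewrite ler_nat.
  + by move=> k; rewrite lebesgue_measure_itv/= ltry leey.
  + apply/ae_itv_measure; apply: aeW => x _.
    exists (Num.bound `|x|); have := archi_boundP (normr_ge0 x).
    by have := ler_norm x; have := ler0n R (Num.bound `|x|); lra.
- exact: seq_tandori_same.
Qed.
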